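(* Let $\mathcal M$ be a 4-dimensional manifold with a III-generic metric $g$, whose selfdual part of the Weyl tensor is in addition algebraically special at all points of $\mathcal M$. Let $\mathcal N$ be the corresponding field of multiple principal (selfdual) totally null 2-planes on $\mathcal M$. If the Cotton tensor $A$ of $g$ satisfies $A(\,\cdot\,,Z_1,Z_2)\equiv 0$ for all $Z_1,Z_2\in\mathcal N$, then the field $\mathcal N$ is integrable, $[\mathcal N,\mathcal N]\subset\mathcal N$, on $\mathcal M$.
   Context: $g$ is a complex-valued metric (a nondegenerate symmetric complex bilinear form on ${\rm T}^{\mathbb C}\mathcal M$; real metrics of any signature are included by complex bilinear extension). A field of totally null 2-planes is a (smooth) complex rank-2 subbundle $\mathcal N\subset{\rm T}^{\mathbb C}\mathcal M$ with $g_{|\mathcal N}\equiv0$; given an orientation, it is selfdual or antiselfdual according to whether the Hodge star (normalized to square to the identity on bivectors) acts on $n_1\wedge n_2$, $n_1,n_2\in\mathcal N$, as $+1$ or $-1$. Curvature: $R(e_c,e_d)e_b=R^a{}_{bcd}e_a$, $R_{ab}=R^c{}_{acb}$, $R=g^{ab}R_{ab}$, Schouten tensor $\mathsf P_{ab}=\tfrac12R_{ab}-\tfrac1{12}Rg_{ab}$, Weyl tensor $C_{abcd}=R_{abcd}+g_{ad}\mathsf P_{cb}-g_{ac}\mathsf P_{db}+g_{bc}\mathsf P_{da}-g_{bd}\mathsf P_{ca}$, Cotton tensor $A_{abc}=\nabla_b\mathsf P_{ca}-\nabla_c\mathsf P_{ba}$, $A(X,Y,Z)=A_{abc}X^aY^bZ^c$.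 A null frame is a local frame $(m,p,n,k)$ of ${\rm T}^{\mathbb C}\mathcal M$ with $g(m,p)=g(n,k)=1$, all other products of frame vectors zero; take it such that ${\rm Span}_{\mathbb C}(m,k)$ is selfdual. The selfdual part of the Weyl tensor has components $\Psi_0=C(m,k,m,k)$, $\Psi_1=C(m,k,n,k)$, $\Psi_2=C(m,k,p,n)$, $\Psi_3=C(p,n,m,p)$, $\Psi_4=C(p,n,p,n)$. The selfdual totally null plane ${\rm Span}_{\mathbb C}(m+zn,k-zp)$ (or ${\rm Span}_{\mathbb C}(n,p)$ for $z=\infty$) is principal if $z$ is a root in $\mathbb C\cup\{\infty\}$ of $\Psi_4z^4-4\Psi_3z^3+6\Psi_2z^2+4\Psi_1z+\Psi_0$, and multiple principal if $z$ is a multiple root. The selfdual part of the Weyl tensor is algebraically special at a point if a multiple principal plane exists there. In a frame with $\mathcal N={\rm Span}_{\mathbb C}(m,k)$, $\mathcal N$ is multiple principal iff $\Psi_0\equiv\Psi_1\equiv0$. Petrov types at a point: type N if the quartic has a root of multiplicity four, type 0 if the selfdual part of the Weyl tensor vanishes. The metric $g$ is III-generic if the points where its selfdual part of the Weyl tensor is of type N or 0 belong to closed sets without interior in $\mathcal M$. *)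

(* Defs.v *)
(* Geometric objects on a manifold are given by their
   components in every chart of the atlas, subject to the transformation law
   under changes of coordinates.  Tangent vectors are row vectors. *)
From HB Require Import structures.
From mathcomp Require Import all_boot all_order all_algebra.
From mathcomp Require Import complex.
From mathcomp Require Import all_classical all_reals all_analysis.

Set Implicit Arguments.
Unset Strict Implicit.
Unset Printing Implicit Defensive.
Import Order.TTheory GRing.Theory Num.Theory.
Import numFieldNormedType.Exports.
Local Open Scope classical_set_scope.
Local Open Scope ring_scope.

Section Smoothness.
Context {R : realType}.
Implicit Types (V : set 'rV[R]_4) (y : 'rV[R]_4).

Definition partial (i : 'I_4) (f : 'rV[R]_4 -> R) y : R :=
  'D_(delta_mx 0 i) (f : 'rV[R]_4 -> R^o) y.

(* C^infinity on the open set V: all iterated partial derivatives exist and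
   are (totally) differentiable on V. *)
Definition smooth_on V (f : 'rV[R]_4 -> R) : Prop :=
  forall (s : seq 'I_4) y, V y ->
    differentiable (foldr partial f s : 'rV[R]_4 -> R^o) y.

Definition csmooth_on V (f : 'rV[R]_4 -> R[i]) : Prop :=
  smooth_on V (fun y => complex.Re (f y)) /\
  smooth_on V (fun y => complex.Im (f y)).

Definition mxsmooth_on m n V (f : 'rV[R]_4 -> 'M[R]_(m, n)) : Prop :=
  forall i j, smooth_on V (fun y => f y i j).

Definition cmxsmooth_on m n V (f : 'rV[R]_4 -> 'M[R[i]]_(m, n)) : Prop :=
  forall i j, csmooth_on V (fun y => f y i j).

Definition cpartial (i : 'I_4) (f : 'rV[R]_4 -> R[i]) y : R[i] :=
  (partial i (fun z => complex.Re (f z)) y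
   +i* partial i (fun z => complex.Im (f z)) y)%C.

(* The Lie bracket of complex vector fields, in coordinates. *)
Definition lie_bracket (X Y : 'rV[R]_4 -> 'rV[R[i]]_4) y : 'rV[R[i]]_4 :=
  \row_a \sum_b (X y 0 b * cpartial b (fun z => Y z 0 a) y
               - Y y 0 b * cpartial b (fun z => X z 0 a) y).

End Smoothness.

Section Curvature.
Context {R : realType} (G : 'rV[R]_4 -> 'M[R[i]]_4).
Implicit Types (a b c d e : 'I_4) (y : 'rV[R]_4).

(* G^a_{bc}, with nabla_c e_b = G^a_{bc} e_a *)
Definition christoffel a b c y : R[i] :=
  2^-1 * \sum_d invmx (G y) a d *
    (cpartial b (fun z => G z d c) y + cpartial c (fun z => G z d b) y
     - cpartial d (fun z => G z b c) y).

(* R^a_{bcd}, with R(e_c, e_d) e_b = R^a_{bcd} e_a *)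
Definition riemann_up a b c d y : R[i] :=
  cpartial c (christoffel a b d) y - cpartial d (christoffel a b c) y
  + \sum_e (christoffel a e c y * christoffel e b d y
            - christoffel a e d y * christoffel e b c y).

Definition riemann a b c d y : R[i] :=
  \sum_e G y a e * riemann_up e b c d y.

Definition ricci a b y : R[i] := \sum_c riemann_up c a c b y.

Definition scalar_curvature y : R[i] :=
  \sum_a \sum_b invmx (G y) a b * ricci a b y.

Definition schouten a b y : R[i] :=
  2^-1 * ricci a b y - 12^-1 * scalar_curvature y * G y a b.

Definition weyl a b c d y : R[i] :=
  riemann a b c d y
  + G y a d * schouten c b y - G y a c * schouten d b y
  + G y b c * schouten d a y - G y b d * schouten c a y.

(* nabla_c P_{ab} *)
Definition nabla_schouten c a b y : R[i] :=
  cpartial c (schouten a b) y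
  - \sum_e (christoffel e a c y * schouten e b y
            + christoffel e b c y * schouten a e y).

Definition cotton a b c y : R[i] :=
  nabla_schouten b c a y - nabla_schouten c b a y.

Definition weyl_at y (X Y Z W : 'rV[R[i]]_4) : R[i] :=
  \sum_a \sum_b \sum_c \sum_d
    weyl a b c d y * X 0 a * Y 0 b * Z 0 c * W 0 d.

Definition cotton_at y (X Y Z : 'rV[R[i]]_4) : R[i] :=
  \sum_a \sum_b \sum_c cotton a b c y * X 0 a * Y 0 b * Z 0 c.

Definition inner y (v w : 'rV[R[i]]_4) : R[i] := (v *m G y *m w^T) 0 0.

End Curvature.

Section Duality.
Context {R : realType} (G : 'rV[R]_4 -> 'M[R[i]]_4) (vol : 'rV[R]_4 -> R[i]).
Implicit Types (y : 'rV[R]_4) (v w m p n k : 'rV[R[i]]_4).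
Implicit Types P : {vspace 'rV[R[i]]_4}.

Definition levi_civita (a b c d : 'I_4) : R[i] :=
  \det (\matrix_(r < 4, s < 4) (tnth [tuple a; b; c; d] r == s)%:R).

(* F^{cd} |-> 1/2 eta_{abcd} F^{cd}, where eta is the complex volume form with
   eta_{0123} = vol *)
Definition dual_form y (F : 'M[R[i]]_4) : 'M[R[i]]_4 :=
  \matrix_(a, b) (2^-1 * \sum_c \sum_d vol y * levi_civita a b c d * F c d).

(* Hodge star on bivectors F^{ab} and on 2-forms F_{ab}; both square to the
   identity as soon as (vol y)^2 = det (G y), see the record orientation. *)
Definition hodge_bivector y (F : 'M[R[i]]_4) : 'M[R[i]]_4 :=
  invmx (G y) *m dual_form y F *m (invmx (G y))^T.

Definition hodge_form y (F : 'M[R[i]]_4) : 'M[R[i]]_4 :=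
  dual_form y (invmx (G y) *m F *m (invmx (G y))^T).

Definition wedge v w : 'M[R[i]]_4 := v^T *m w - w^T *m v.

Definition totally_null y P : Prop :=
  forall v w, v \in P -> w \in P -> inner G y v w = 0.

Definition selfdual_plane y P : Prop :=
  forall v w, v \in P -> w \in P -> hodge_bivector y (wedge v w) = wedge v w.

(* C^+ = (C + *C) / 2 *)
Definition weyl_selfdual a b c d y : R[i] :=
  2^-1 * (weyl G a b c d y
          + hodge_form y (\matrix_(e, f) weyl G e f c d y) a b).

Definition null_frame y m p n k : Prop :=
  [/\ inner G y m p = 1 /\ inner G y n k = 1,
      [/\ inner G y m m = 0, inner G y p p = 0,
          inner G y n n = 0 & inner G y k k = 0]
    & [/\ inner G y m n = 0, inner G y m k = 0,
          inner G y p n = 0 & inner G y p k = 0]].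

Definition adapted_null_frame y m p n k : Prop :=
  null_frame y m p n k /\ selfdual_plane y <<[:: m; k]>>%VS.

Definition Psi0 y m p n k := weyl_at G y m k m k.
Definition Psi1 y m p n k := weyl_at G y m k n k.
Definition Psi2 y m p n k := weyl_at G y m k p n.
Definition Psi3 y m p n k := weyl_at G y p n m p.
Definition Psi4 y m p n k := weyl_at G y p n p n.

Definition weyl_quartic y m p n k : {poly R[i]} :=
  Psi4 y m p n k *: 'X^4 - (4 * Psi3 y m p n k) *: 'X^3
  + (6 * Psi2 y m p n k) *: 'X^2 + (4 * Psi1 y m p n k) *: 'X
  + (Psi0 y m p n k)%:P.

(* z is a root of multiplicity at least j of the quartic Q, None standing for
   the point at infinity.  Every z is such a root of the zero quartic. *)
Definition quartic_root (Q : {poly R[i]}) (z : option R[i]) (j : nat) : Prop :=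
  if z is Some t then ('X - t%:P) ^+ j %| Q else (size Q <= 5 - j)%N.

Definition frame_plane m p n k (z : option R[i]) : {vspace 'rV[R[i]]_4} :=
  if z is Some t then <<[:: (m + t *: n)%R; (k - t *: p)%R]>>%VS
  else <<[:: n; p]>>%VS.

Definition multiple_principal y P : Prop :=
  exists m p n k z, [/\ adapted_null_frame y m p n k,
    P = frame_plane m p n k z & quartic_root (weyl_quartic y m p n k) z 2].

Definition algebraically_special y : Prop := exists P, multiple_principal y P.

Definition type_N y : Prop :=
  exists m p n k z, [/\ adapted_null_frame y m p n k,
    weyl_quartic y m p n k != 0 & quartic_root (weyl_quartic y m p n k) z 4].

Definition type_0 y : Prop := forall a b c d, weyl_selfdual a b c d y = 0.

End Duality.

Record chart (R : realType) (M : topologicalType) := Chart {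
  dom : set M;
  cod : set 'rV[R]_4;
  chart_map : M -> 'rV[R]_4;
  chart_inv : 'rV[R]_4 -> M;
  dom_open : open dom;
  cod_open : open cod;
  chart_map_cod : forall x, dom x -> cod (chart_map x);
  chart_inv_dom : forall y, cod y -> dom (chart_inv y);
  chart_mapK : forall x, dom x -> chart_inv (chart_map x) = x;
  chart_invK : forall y, cod y -> chart_map (chart_inv y) = y;
  chart_map_continuous : {within dom, continuous chart_map};
  chart_inv_continuous : {within cod, continuous chart_inv} }.

(* Change of coordinates from c to c', and the set where it is meaningful. *)
Definition transition (R : realType) (M : topologicalType) (c c' : chart R M)
  (y : 'rV[R]_4) : 'rV[R]_4 := chart_map c' (chart_inv c y).

Definition overlap (R : realType) (M : topologicalType) (c c' : chart R M) :
  set 'rV[R]_4 := [set y | cod c y /\ dom c' (chart_inv c y)].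

(* Its Jacobian matrix, acting on complex row vectors from the right. *)
Definition cjacobian (R : realType) (M : topologicalType) (c c' : chart R M)
  (y : 'rV[R]_4) : 'M[R[i]]_4 :=
  map_mx (real_complex R) (jacobian (transition c c') y).

Record manifold4 (R : realType) := Manifold4 {
  points :> topologicalType;
  hausdorff_points : hausdorff_space points;
  second_countable_points : @second_countable points;
  chart_index : Type;
  atlas : chart_index -> chart R points;
  atlas_cover : forall x, exists i, dom (atlas i) x;
  atlas_smooth : forall i j, mxsmooth_on (overlap (atlas i) (atlas j))
                               (transition (atlas i) (atlas j)) }.

Record cmetric (R : realType) (M : manifold4 R) := CMetric {
  metric : chart_index M -> 'rV[R]_4 -> 'M[R[i]]_4;
  metric_smooth : forall i, cmxsmooth_on (cod (atlas i)) (metric i);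
  metric_sym : forall i y, cod (atlas i) y -> (metric i y)^T = metric i y;
  metric_nondegenerate : forall i y, cod (atlas i) y -> metric i y \in unitmx;
  metric_compat : forall i j y, overlap (atlas i) (atlas j) y ->
    let J := cjacobian (atlas i) (atlas j) y in
    metric i y = J *m metric j (transition (atlas i) (atlas j) y) *m J^T }.

(* For a complex-valued metric an orientation is a complex volume 4-form
   (vol is its component eta_{0123}) normalized so that the Hodge star squares
   to the identity on bivectors. *)
Record orientation (R : realType) (M : manifold4 R) (g : cmetric M) :=
  Orientation {
  vol : chart_index M -> 'rV[R]_4 -> R[i];
  vol_smooth : forall i, csmooth_on (cod (atlas i)) (vol i);
  vol_normalized : forall i y, cod (atlas i) y ->
    vol i y ^+ 2 = \det (metric g i y);
  vol_compat : forall i j y, overlap (atlas i) (atlas j) y ->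
    vol i y = \det (cjacobian (atlas i) (atlas j) y)
              * vol j (transition (atlas i) (atlas j) y) }.

Record null_plane_field (R : realType) (M : manifold4 R) (g : cmetric M) :=
  NullPlaneField {
  plane : chart_index M -> 'rV[R]_4 -> {vspace 'rV[R[i]]_4};
  plane_dim : forall i y, cod (atlas i) y -> \dim (plane i y) = 2;
  plane_smooth : forall i y, cod (atlas i) y ->
    exists W X1 X2, [/\ open W, W y,
      cmxsmooth_on W X1, cmxsmooth_on W X2 &
      forall z, W z -> cod (atlas i) z ->
        plane i z = <<[:: X1 z; X2 z]>>%VS];
  plane_compat : forall i j y, overlap (atlas i) (atlas j) y -> forall v,
    (v *m cjacobian (atlas i) (atlas j) y
       \in plane j (transition (atlas i) (atlas j) y)) = (v \in plane i y);
  plane_null : forall i y, cod (atlas i) y ->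
    totally_null (metric g i) y (plane i y) }.

Section Global.
Context {R : realType} {M : manifold4 R} {g : cmetric M}.

Definition III_generic (o : orientation g) : Prop :=
  exists F : set M, [/\ closed F, interior F = set0 &
    forall i x, dom (atlas i) x ->
      let y := chart_map (atlas i) x in
      type_N (metric g i) (vol o i) y \/ type_0 (metric g i) (vol o i) y ->
      F x].

Definition algebraically_special_everywhere (o : orientation g) : Prop :=
  forall i y, cod (atlas i) y ->
    algebraically_special (metric g i) (vol o i) y.

Definition selfdual_field (o : orientation g) (N : null_plane_field g) : Prop :=
  forall i y, cod (atlas i) y ->
    selfdual_plane (metric g i) (vol o i) y (plane N i y).

Definition multiple_principal_field (o : orientation g)
    (N : null_plane_field g) : Prop :=
  forall i y, cod (atlas i) y ->
    multiple_principal (metric g i) (vol o i) y (plane N i y).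

(* A( . , Z1, Z2) = 0 for all Z1, Z2 in N *)
Definition cotton_vanishes_on (N : null_plane_field g) : Prop :=
  forall i y, cod (atlas i) y -> forall X Z1 Z2,
    Z1 \in plane N i y -> Z2 \in plane N i y ->
    cotton_at (metric g i) y X Z1 Z2 = 0.

(* [N, N] is contained in N *)
Definition integrable_field (N : null_plane_field g) : Prop :=
  forall i (W : set 'rV[R]_4) (X Y : 'rV[R]_4 -> 'rV[R[i]]_4),
    open W -> W `<=` cod (atlas i) ->
    cmxsmooth_on W X -> cmxsmooth_on W Y ->
    (forall y, W y -> X y \in plane N i y) ->
    (forall y, W y -> Y y \in plane N i y) ->
    forall y, W y -> lie_bracket X Y y \in plane N i y.

End Global.

(* Main.v *)
(** Let the field of planes N be spanned by m and k, completed to a null frame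
    (m, p, n, k), and put sigma(v) = g(nabla_v m, k).  Since N is its own
    orthogonal, N is integrable iff sigma vanishes on N.  The contracted second
    Bianchi identity says that the divergence of the Weyl tensor C is the Cotton
    tensor.  That N is multiple principal means C(N, N, N, .) = 0;
    differentiating this and inserting it into the divergence identity
    A(Z3, Z1, Z2) = 0 gives Psi2 sigma = 0 on N.  If sigma is nonzero on N at a
    point, then Psi2 = 0 nearby, hence C(., ., N, N) = 0 nearby, and the same
    argument one order higher gives Psi3 sigma = 0 on N.  So the type is N or 0
    on an open set, which III-genericity excludes. *)

From HB Require Import structures.
From mathcomp Require Import all_boot all_order all_algebra.
From mathcomp Require Import complex.
From mathcomp Require Import all_classical all_reals all_analysis.
From mathcomp Require Import ring.
Require Import Defs.

Set Implicit Arguments.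
Unset Strict Implicit.
Unset Printing Implicit Defensive.
Import Order.TTheory GRing.Theory Num.Theory.
Import numFieldNormedType.Exports.
Local Open Scope classical_set_scope.
Local Open Scope ring_scope.

(** * Curvature over a commutative ring with commuting derivations *)

(** Only the plane comes with smooth local sections [X1], [X2]. The complementary vectors [p], [n]
    are chosen separately at each point, and this suffices: the divergence is a trace at one point,
    in which [p] and [n] occur as directions and arguments but are never differentiated as fields.
    An argument outside the plane is extended with constant components, because the term containing
    its derivative vanishes. The trace gives A(m, m, k) = -3 sigma(m) Psi2 and, once Psi2 = 0
    nearby, A(n, m, k) = 2 sigma(m) Psi3; the coefficients of the other values of sigma cancel.
    Exchanging m and k yields sigma(k). The contracted Bianchi identity involves third derivatives
    of the metric. It is proved over any commutative ring with commuting derivations, where it is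
    pure algebra; the ring used later is that of functions smooth on an open set, and evaluation at
    a point is a ring morphism. Type 0 is defined through the Hodge star, so the vanishing of the
    Psi has to be translated by computing the star in a null frame, whose orientation is fixed by
    the selfduality of the plane. *)

Section Evaluation.
Variable A : comPzRingType.
Implicit Types u v w z : 'I_4 -> A.

Definition ev1 u (T : 'I_4 -> A) : A := \sum_a u a * T a.

Definition ev2 (T : 'I_4 -> 'I_4 -> A) u v : A :=
  ev1 u (fun a => ev1 v (T a)).

(** Nested rather than a flat quadruple sum, so that the Leibniz rule and the exchange of arguments
    are proved one slot at a time; [ev4E] recovers the flat sum of [weyl_at]. *)
Definition ev4 (T : 'I_4 -> 'I_4 -> 'I_4 -> 'I_4 -> A) u v w z : A :=
  ev1 u (fun a => ev1 v (fun b => ev2 (T a b) w z)).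

Lemma eq_ev1 u u' T T' : u =1 u' -> T =1 T' -> ev1 u T = ev1 u' T'.
Proof. by move=> eu eT; apply: eq_bigr => a _; rewrite eu eT. Qed.

Lemma ev1D u T T' : ev1 u (fun a => T a + T' a) = ev1 u T + ev1 u T'.
Proof. by rewrite -big_split; apply: eq_bigr => a _; rewrite mulrDr. Qed.

Lemma ev1Z x u T : x * ev1 u T = ev1 u (fun a => x * T a).
Proof. by rewrite mulr_sumr; apply: eq_bigr => a _; rewrite mulrCA. Qed.

Lemma ev1_exchange u v (T : 'I_4 -> 'I_4 -> A) :
  ev1 u (fun a => ev1 v (T a)) = ev1 v (fun b => ev1 u (fun a => T a b)).
Proof.
rewrite /ev1; under eq_bigr do rewrite mulr_sumr.
rewrite exchange_big; apply: eq_bigr => b _; rewrite mulr_sumr.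
by apply: eq_bigr => a _; rewrite mulrCA.
Qed.

Lemma ev1N u T : ev1 u (fun a => - T a) = - ev1 u T.
Proof. by rewrite /ev1 -sumrN; apply: eq_bigr => a _; rewrite mulrN. Qed.

Lemma eq_ev4 T T' u v w z : (forall a b c d, T a b c d = T' a b c d) ->
  ev4 T u v w z = ev4 T' u v w z.
Proof. by move=> TT; do 4! apply: eq_ev1 => // ?. Qed.

Lemma ev4_swap12 T u v w z : ev4 T v u w z = ev4 (fun a b c d => T b a c d) u v w z.
Proof. exact: ev1_exchange. Qed.

Lemma ev4_swap23 T u v w z : ev4 T u w v z = ev4 (fun a b c d => T a c b d) u v w z.
Proof. by apply: eq_ev1 => // a; exact: ev1_exchange. Qed.

Lemma ev4_swap34 T u v w z : ev4 T u v z w = ev4 (fun a b c d => T a b d c) u v w z.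
Proof. by apply: eq_ev1 => // a; apply: eq_ev1 => // b; exact: ev1_exchange. Qed.

Lemma ev4N T u v w z : ev4 (fun a b c d => - T a b c d) u v w z = - ev4 T u v w z.
Proof.
rewrite -ev1N; apply: eq_ev1 => // a; rewrite -ev1N; apply: eq_ev1 => // b.
by rewrite -ev1N; apply: eq_ev1 => // c; rewrite -ev1N.
Qed.

Lemma ev4D T T' u v w z :
  ev4 (fun a b c d => T a b c d + T' a b c d) u v w z = ev4 T u v w z + ev4 T' u v w z.
Proof.
rewrite -ev1D; apply: eq_ev1 => // a; rewrite -ev1D; apply: eq_ev1 => // b.
by rewrite -ev1D; apply: eq_ev1 => // c; rewrite -ev1D.
Qed.

Lemma ev40 T u v w z : (forall a b c d, T a b c d = 0) -> ev4 T u v w z = 0.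
Proof.
have e0 (x F : 'I_4 -> A) : (forall a, F a = 0) -> ev1 x F = 0.
  by move=> F0; apply: big1 => a _; rewrite F0 mulr0.
move=> T0; apply: (e0 u) => a; apply: (e0 v) => b; apply: (e0 w) => c.
exact: (e0 z).
Qed.

Lemma ev4E T u v w z : ev4 T u v w z =
  \sum_a \sum_b \sum_c \sum_d T a b c d * u a * v b * w c * z d.
Proof.
apply: eq_bigr => a _; rewrite mulr_sumr; apply: eq_bigr => b _.
rewrite !mulr_sumr; apply: eq_bigr => c _; rewrite !mulr_sumr; apply: eq_bigr => d _.
by ring.
Qed.

End Evaluation.

Section EvaluationMorphism.
Variables (A B : comPzRingType) (phi : {rmorphism A -> B}).

Lemma rmorph_ev1 u T : phi (ev1 u T) = ev1 (fun a => phi (u a)) (fun a => phi (T a)).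
Proof. by rewrite rmorph_sum; apply: eq_bigr => a _; rewrite rmorphM. Qed.

Lemma rmorph_ev2 T u v : phi (ev2 T u v) =
  ev2 (fun a b => phi (T a b)) (fun a => phi (u a)) (fun a => phi (v a)).
Proof. by rewrite rmorph_ev1; apply: eq_ev1 => // a; rewrite rmorph_ev1. Qed.

Lemma rmorph_ev4 T u v w z : phi (ev4 T u v w z) =
  ev4 (fun a b c d => phi (T a b c d)) (fun a => phi (u a)) (fun a => phi (v a))
    (fun a => phi (w a)) (fun a => phi (z a)).
Proof.
rewrite rmorph_ev1; apply: eq_ev1 => // a; rewrite rmorph_ev1.
by apply: eq_ev1 => // b; exact: rmorph_ev2.
Qed.

End EvaluationMorphism.

(** * Levi-Civita connection, Bianchi identities and the divergence of the Weyl tensor *)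

Section AbstractCurvature.
Variables (A : comPzRingType) (D : 'I_4 -> A -> A) (half twelfth : A).
Variables G Gi : 'M[A]_4.
Hypothesis DD : forall i x y, D i (x + y) = D i x + D i y.
Hypothesis DM : forall i x y, D i (x * y) = D i x * y + x * D i y.
Hypothesis DC : forall i j x, D i (D j x) = D j (D i x).
Hypothesis half2 : half * 2 = 1.
Hypothesis twelfth12 : twelfth * 12 = 1.
Hypothesis Gsym : forall a b, G a b = G b a.
Hypothesis GGi : G *m Gi = 1%:M.
Implicit Types (a b c d e f : 'I_4) (u v w z : 'I_4 -> A).

Lemma derD0 i : D i 0 = 0.
Proof. by apply: (@addrI _ (D i 0)); rewrite -DD !addr0. Qed.

Lemma derN i x : D i (- x) = - D i x.
Proof. by apply: (@addrI _ (D i x)); rewrite -DD !subrr derD0. Qed.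

Lemma derB i x y : D i (x - y) = D i x - D i y.
Proof. by rewrite DD derN. Qed.

Lemma der_sum i (I : Type) (r : seq I) (P : pred I) (F : I -> A) :
  D i (\sum_(j <- r | P j) F j) = \sum_(j <- r | P j) D i (F j).
Proof. exact: (big_morph (D i) (DD i) (derD0 i)). Qed.

Lemma der1 i : D i 1 = 0.
Proof. by apply: (@addrI _ (D i 1)); rewrite addr0 -{3}[1]mulr1 DM mulr1 mul1r. Qed.

(** Applied to [half] and [twelfth]: the Leibniz rule on [x * n%:R = 1] forces these elements to be
    constants of the derivations. *)
Lemma der_inv_nat i x n : x * n%:R = 1 -> D i x = 0.
Proof.
move=> xn; have Dn : D i n%:R = 0.
  by elim: n {xn} => [|n IH]; rewrite ?derD0// -addn1 natrD DD IH der1 addr0.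
have := congr1 (D i) xn; rewrite DM Dn mulr0 addr0 der1 => /(congr1 ( *%R^~ x)).
by rewrite -mulrA (mulrC _ x) xn mulr1 mul0r.
Qed.

Lemma half_inj (x y : A) : 2 * x = 2 * y -> x = y.
Proof.
by move=> /(congr1 ( *%R half)); rewrite !mulrA half2 !mul1r.
Qed.

Lemma half_twelfth : half = 6 * twelfth.
Proof.
rewrite -[LHS](mulr1 half) -{1}twelfth12.
by transitivity (half * 2 * (6 * twelfth)); [ring | rewrite half2 mul1r].
Qed.

Definition dermx n p i (X : 'M[A]_(n, p)) : 'M[A]_(n, p) := map_mx (D i) X.

Lemma dermxD n p i (X Y : 'M[A]_(n, p)) : dermx i (X + Y) = dermx i X + dermx i Y.
Proof. by apply/matrixP=> a b; rewrite !mxE DD. Qed.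

Lemma dermxN n p i (X : 'M[A]_(n, p)) : dermx i (- X) = - dermx i X.
Proof. by apply/matrixP=> a b; rewrite !mxE derN. Qed.

Lemma dermxM n p q i (X : 'M[A]_(n, p)) (Y : 'M[A]_(p, q)) :
  dermx i (X *m Y) = dermx i X *m Y + X *m dermx i Y.
Proof.
apply/matrixP=> a b; rewrite !mxE der_sum -big_split.
by apply: eq_bigr => c _; rewrite DM !mxE.
Qed.

Lemma dermxC n p i j (X : 'M[A]_(n, p)) : dermx i (dermx j X) = dermx j (dermx i X).
Proof. by apply/matrixP=> a b; rewrite !mxE DC. Qed.

Lemma dermxT n p i (X : 'M[A]_(n, p)) : dermx i X^T = (dermx i X)^T.
Proof. by apply/matrixP=> a b; rewrite !mxE. Qed.

Lemma GT : G^T = G.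
Proof. by apply/matrixP=> a b; rewrite mxE Gsym. Qed.

Lemma GiG : Gi *m G = 1%:M.
Proof. exact: mulmx1C GGi. Qed.

Lemma GiT : Gi^T = Gi.
Proof.
by rewrite -[Gi in RHS]mul1mx -(trmx1 A 4) -GGi trmx_mul GT -mulmxA GGi mulmx1.
Qed.

Lemma Gisym a b : Gi a b = Gi b a.
Proof. by rewrite -{1}GiT mxE. Qed.

Definition chr a b c : A :=
  half * \sum_d Gi a d * (D b (G d c) + D c (G d b) - D d (G b c)).

Lemma chr_sym a b c : chr a b c = chr a c b.
Proof.
congr (_ * _); apply: eq_bigr => d _; congr (_ * _).
by rewrite (Gsym b c) addrC (addrC (D c _)) addrC.
Qed.

(* [connection c b a] is the coefficient of [e_a] in [nabla_c e_b]. *)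
Definition connection c : 'M[A]_4 := \matrix_(b, a) chr a b c.

(** Christoffel symbols of the first kind: lowering the upper index cancels [Gi]. *)
Lemma connectionG c b f : (connection c *m G) b f =
  half * (D b (G f c) + D c (G f b) - D f (G b c)).
Proof.
rewrite mxE; under eq_bigr do rewrite mxE mulrC /chr mulrCA mulr_sumr.
rewrite -mulr_sumr exchange_big /=; congr (_ * _).
under eq_bigr => d _.
  under eq_bigr do rewrite mulrA Gsym.
  rewrite -mulr_suml.
  have -> : \sum_i G f i * Gi i d = (f == d)%:R by have /matrixP/(_ f d) := GGi; rewrite !mxE.
  over.
rewrite (bigD1 f)//= eqxx mul1r big1 ?addr0// => d /negPf df.
by rewrite eq_sym df mul0r.
Qed.

(** Symmetrizing the first-kind symbols in the two matrix indices cancels every derivative except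
    the one in direction [c], which is counted twice. *)
Lemma metric_compatible c :
  dermx c G = connection c *m G + G *m (connection c)^T.
Proof.
have -> : G *m (connection c)^T = (connection c *m G)^T by rewrite trmx_mul GT.
apply/matrixP=> a b; rewrite [in RHS]mxE [_^T a b]mxE !connectionG mxE.
rewrite (Gsym b a) (Gsym b c) (Gsym a c) -mulrDr.
transitivity (half * 2 * D c (G a b)); first by rewrite half2 mul1r.
by ring.
Qed.

Lemma der_metric c a b :
  D c (G a b) = \sum_e (chr e a c * G e b + chr e b c * G a e).
Proof.
have /matrixP/(_ a b) := metric_compatible c; rewrite !mxE => ->.
by rewrite -big_split; apply: eq_bigr => e _; rewrite !mxE (mulrC (G a e)).
Qed.

Lemma dermx_inverse c :
  dermx c Gi = - (Gi *m connection c) - (connection c)^T *m Gi.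
Proof.
have /(congr1 (dermx c)) := GGi; rewrite dermxM.
have -> : dermx c (1%:M : 'M[A]_4) = 0.
  by apply/matrixP=> a b; rewrite !mxE; case: (a == b); rewrite ?der1 ?derD0.
move=> /eqP; rewrite addrC addr_eq0 => /eqP /(congr1 (mulmx Gi)).
rewrite mulmxA GiG mul1mx => ->.
rewrite metric_compatible mulmxN mulmxDl mulmxDr !mulmxA GiG mul1mx opprD.
by rewrite -!mulmxA GGi mulmx1.
Qed.

Lemma der_inverse c a b :
  D c (Gi a b) = - \sum_f (chr a f c * Gi f b + chr b f c * Gi a f).
Proof.
have /matrixP/(_ a b) := dermx_inverse c; rewrite !mxE => ->.
rewrite -opprD -big_split /=; congr (- _); apply: eq_bigr => f _.
by rewrite !mxE addrC mulrC; congr (_ + _); rewrite mulrC.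
Qed.

Definition rmu a b c d : A :=
  D c (chr a b d) - D d (chr a b c)
  + \sum_e (chr a e c * chr e b d - chr a e d * chr e b c).

Definition rm a b c d : A := \sum_e G a e * rmu e b c d.

(** The curvature 2-form of the connection matrices. The products come in the opposite order to the
    usual one because [connection] carries the source index first, as for an action on row
    vectors. *)
Definition curv c d : 'M[A]_4 :=
  dermx c (connection d) - dermx d (connection c)
  + connection d *m connection c - connection c *m connection d.

Lemma curvE a b c d : rmu a b c d = curv c d b a.
Proof.
rewrite !mxE -addrA; congr (_ + _); rewrite -sumrB; apply: eq_bigr => e _.
by rewrite !mxE mulrC (mulrC (chr a e d)).
Qed.

Lemma rmE a b c d : rm a b c d = (curv c d *m G) b a.
Proof.
by rewrite mxE; apply: eq_bigr => e _; rewrite curvE mulrC Gsym.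
Qed.

Lemma curvN c d : curv d c = - curv c d.
Proof. by apply/matrixP=> a b; rewrite !mxE; ring. Qed.

Lemma rm_asym34 a b c d : rm a b d c = - rm a b c d.
Proof. by rewrite !rmE curvN mulNmx mxE. Qed.

(** Second derivatives of [G] commute; expanding both orders by metric compatibility leaves exactly
    the symmetric part of [curv c d *m G]. *)
Lemma rm_asym12 a b c d : rm b a c d = - rm a b c d.
Proof.
have key : (curv c d *m G)^T = - (curv c d *m G).
  have trD (X Y : 'M[A]_4) : (X + Y)^T = X^T + Y^T by exact: raddfD.
  have trN (X : 'M[A]_4) : (- X)^T = - X^T by exact: raddfN.
  have := dermxC c d G; rewrite !metric_compatible !dermxD !dermxM !dermxT.
  rewrite !metric_compatible => E.
  rewrite trmx_mul GT /curv !(trD, trN) !trmx_mul.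
  rewrite !(mulmxDl, mulmxDr, mulNmx, mulmxN) in E *.
  rewrite !mulmxA in E *.
  move/eqP: E; rewrite -subr_eq0 => /eqP E; apply/eqP.
  rewrite -addr_eq0 -[X in _ == X]E; apply/eqP/matrixP=> x z.
  move: (_ *m G) (G *m _) => *.
  by rewrite !mxE; ring.
rewrite !rmE; have := congr1 (fun (X : 'M[A]_4) => X b a) key.
by rewrite /= [LHS]mxE [RHS]mxE.
Qed.

(** First Bianchi identity: absence of torsion, [chr_sym], makes all terms cancel in pairs. *)
Lemma rmu_cycle a b c d : rmu a b c d + rmu a c d b + rmu a d b c = 0.
Proof.
have S (x y z : 'I_4) : \sum_e chr a e x * chr e y z = \sum_e chr a e x * chr e z y.
  by apply: eq_bigr => e _; rewrite (chr_sym e).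
rewrite /rmu !sumrB (S d c b) (S b d c) (S c d b).
rewrite (chr_sym a c b) (chr_sym a d b) (chr_sym a d c).
by ring.
Qed.

Lemma rm_cycle a b c d : rm a b c d + rm a c d b + rm a d b c = 0.
Proof.
rewrite /rm -!big_split big1// => e _ /=.
by rewrite -!mulrDr rmu_cycle mulr0.
Qed.

(** A signed sum of the cyclic identities starting at [a], [b], [c], [d] leaves twice the difference
    of the two sides. *)
Lemma rm_pair a b c d : rm a b c d = rm c d a b.
Proof.
have := rm_cycle a b c d; rewrite (rm_asym34 a c b d) => E1.
have := rm_cycle b c d a.
rewrite (rm_asym34 b c a d) (rm_asym12 a b c d) => E2.
have := rm_cycle c d a b.
rewrite (rm_asym12 a c b d) (rm_asym12 b c d a) (rm_asym34 b c a d) opprK => E3.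
have := rm_cycle d a b c.
rewrite (rm_asym12 a d b c) (rm_asym12 b d c a) (rm_asym34 b d a c).
rewrite (rm_asym12 c d a b) ?opprK => E4.
apply: half_inj; apply/eqP; rewrite -subr_eq0; apply/eqP.
have -> : 2 * rm a b c d - 2 * rm c d a b =
  (rm a b c d - rm a c b d + rm a d b c)
  - (- rm b c a d + rm b d a c - rm a b c d)
  - (rm c d a b - rm a c b d + rm b c a d)
  + (- rm a d b c + rm b d a c - rm c d a b) by ring.
by rewrite E1 E3 E2 E4 !subr0 addr0.
Qed.

(* Covariant derivatives; the first index is the direction of differentiation. *)
Definition cd1 (u : 'I_4 -> A) e a : A := D e (u a) + \sum_f chr a f e * u f.

Definition cd2 (T : 'I_4 -> 'I_4 -> A) e a b : A :=
  D e (T a b) - \sum_f (chr f a e * T f b + chr f b e * T a f).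

Definition cd4 (T : 'I_4 -> 'I_4 -> 'I_4 -> 'I_4 -> A) e a b c d : A :=
  D e (T a b c d)
  - \sum_f (chr f a e * T f b c d + chr f b e * T a f c d
            + chr f c e * T a b f d + chr f d e * T a b c f).

Lemma cd2G e a b : cd2 G e a b = 0.
Proof. by rewrite /cd2 der_metric subrr. Qed.

(** Covariant in the two matrix indices only; [c] and [d] are treated as labels. *)
Definition dcurv e c d : 'M[A]_4 :=
  dermx e (curv c d) + curv c d *m connection e - connection e *m curv c d.

Lemma rm_der e a b c d :
  D e (rm a b c d) - \sum_f (chr f a e * rm f b c d + chr f b e * rm a f c d)
  = (dcurv e c d *m G) b a.
Proof.
rewrite /dcurv; have := fun a b => rmE a b c d; move: (curv c d) => K rmK.
have -> : (dermx e K + K *m connection e - connection e *m K) *m G =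
    dermx e (K *m G) - K *m G *m (connection e)^T - connection e *m (K *m G).
  rewrite dermxM metric_compatible mulmxDr !(mulmxDl, mulNmx) !mulmxA.
  by rewrite [X in X - _ - _]addrA addrK.
rewrite rmK big_split opprD addrA /= [RHS]mxE [X in _ = X + _]mxE.
congr (_ + _ + _); first by rewrite [RHS]mxE.
  rewrite !mxE; congr (- _); apply: eq_bigr => f _.
  by rewrite rmK !mxE mulrC.
by rewrite !mxE; congr (- _); apply: eq_bigr => f _; rewrite rmK !mxE.
Qed.

(** The Jacobi identity for the covariant derivatives, whose commutators are the matrices [curv]. *)
Lemma curv_bianchi c d e :
  dcurv e c d + dcurv c d e + dcurv d e c = 0.
Proof.
rewrite /dcurv /curv !(dermxD, dermxN, dermxM).
rewrite (dermxC d c) (dermxC e c) (dermxC e d).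
move: (connection c) (connection d) (connection e) => X Y Z.
move: (dermx c (dermx d Z)) (dermx c (dermx e Y)) (dermx d (dermx e X)) => Z2 Y2 X2.
rewrite !(mulmxDl, mulmxDr, mulNmx, mulmxN) !mulmxA.
repeat match goal with |- context [?P *m ?Q] => move: (P *m Q) => ? end.
by apply/matrixP=> i j; rewrite !mxE; ring.
Qed.

(** What [curv_bianchi] omits are the connection terms for the labels [c], [d], [e]; in the cyclic
    sum they cancel in pairs by [chr_sym] and antisymmetry ([flip]). *)
Lemma rm_bianchi e a b c d :
  cd4 rm e a b c d + cd4 rm c a b d e + cd4 rm d a b e c = 0.
Proof.
have split4 (x y z : 'I_4) : cd4 rm x a b y z =
  (dcurv x y z *m G) b a - \sum_f chr f y x * rm a b f z - \sum_f chr f z x * rm a b y f.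
  by rewrite -rm_der /cd4 !big_split /=; ring.
have flip (x y z : 'I_4) : \sum_f chr f y x * rm a b z f = - \sum_f chr f x y * rm a b f z.
  by rewrite -sumrN; apply: eq_bigr => f _; rewrite chr_sym rm_asym34 mulrN.
rewrite !split4 (flip e d c) (flip c e d) (flip d c e).
have /(congr1 (fun (X : 'M[A]_4) => (X *m G) b a)) := curv_bianchi c d e.
rewrite mul0mx; move: (dcurv e c d) (dcurv c d e) (dcurv d e c) => X Y Z.
rewrite !mulmxDl; move: (X *m G) (Y *m G) (Z *m G) => {}X {}Y {}Z.
by rewrite !mxE => E; rewrite -[RHS]E; ring.
Qed.

Definition contr (T : 'I_4 -> 'I_4 -> A) : A := \sum_a \sum_b Gi a b * T a b.

Lemma eq_contr T T' : T =2 T' -> contr T = contr T'.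
Proof. by move=> E; apply: eq_bigr => a _; apply: eq_bigr => b _; rewrite E. Qed.

Lemma contrC T : contr (fun a b => T b a) = contr T.
Proof.
rewrite /contr exchange_big; apply: eq_bigr => a _.
by apply: eq_bigr => b _; rewrite Gisym.
Qed.

Lemma contrD T T' : contr (fun a b => T a b + T' a b) = contr T + contr T'.
Proof.
rewrite -big_split; apply: eq_bigr => a _; rewrite -big_split.
by apply: eq_bigr => b _; rewrite mulrDr.
Qed.

Lemma contrZ x T : contr (fun a b => x * T a b) = x * contr T.
Proof.
rewrite mulr_sumr; apply: eq_bigr => a _; rewrite mulr_sumr.
by apply: eq_bigr => b _; rewrite mulrCA.
Qed.

Lemma contrN T : contr (fun a b => - T a b) = - contr T.
Proof.
by rewrite -mulN1r -contrZ; apply: eq_contr => a b; rewrite mulN1r.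
Qed.

Lemma contr_sum (F : 'I_4 -> 'I_4 -> 'I_4 -> A) :
  contr (fun a b => \sum_f F f a b) = \sum_f contr (F f).
Proof.
rewrite /contr [RHS]exchange_big; apply: eq_bigr => a _.
by rewrite [RHS]exchange_big; apply: eq_bigr => b _; rewrite mulr_sumr.
Qed.

Lemma contr_contr (T : 'I_4 -> 'I_4 -> 'I_4 -> 'I_4 -> A) :
  contr (fun a b => contr (fun c d => T a b c d))
  = contr (fun c d => contr (fun a b => T a b c d)).
Proof.
rewrite {1}/contr.
under eq_bigr do under eq_bigr do rewrite -contrZ.
under eq_bigr do rewrite -contr_sum.
by rewrite -contr_sum.
Qed.

Lemma mulGiG a c : \sum_b Gi a b * G b c = (a == c)%:R.
Proof. by have /matrixP/(_ a c) := GiG; rewrite !mxE. Qed.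

Lemma sum_delta (F : 'I_4 -> A) c : \sum_a (a == c)%:R * F a = F c.
Proof.
rewrite (bigD1 c)//= eqxx mul1r big1 ?addr0// => a /negPf ->.
by rewrite mul0r.
Qed.

Lemma contr_metric d (F : 'I_4 -> A) : contr (fun e a => G a d * F e) = F d.
Proof.
rewrite -[RHS](sum_delta F); apply: eq_bigr => e _.
by rewrite -mulGiG mulr_suml; apply: eq_bigr => a _; rewrite mulrA.
Qed.

(** The inverse metric is parallel, so its derivative supplies precisely the connection terms of the
    two contracted slots. *)
Lemma der_contr T e : D e (contr T) = contr (fun a b => cd2 T e a b).
Proof.
have E1 : \sum_a \sum_b \sum_f chr a f e * Gi f b * T a b
    = contr (fun a b => \sum_f chr f a e * T f b).
  under eq_bigr do rewrite exchange_big; rewrite exchange_big.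
  apply: eq_bigr => f _; rewrite exchange_big; apply: eq_bigr => b _.
  by rewrite mulr_sumr; apply: eq_bigr => a _; ring.
have E2 : \sum_a \sum_b \sum_f chr b f e * Gi a f * T a b
    = contr (fun a b => \sum_f chr f b e * T a f).
  apply: eq_bigr => a _; rewrite exchange_big; apply: eq_bigr => b _.
  by rewrite mulr_sumr; apply: eq_bigr => f _; ring.
rewrite /cd2 contrD contrN.
have -> : contr (fun a b => \sum_f (chr f a e * T f b + chr f b e * T a f))
    = contr (fun a b => \sum_f chr f a e * T f b)
      + contr (fun a b => \sum_f chr f b e * T a f).
  by rewrite -contrD; apply: eq_contr => a b; rewrite big_split.
rewrite -E1 -E2 -big_split der_sum -sumrB; apply: eq_bigr => a _ /=.
rewrite -big_split der_sum -sumrB; apply: eq_bigr => b _ /=.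
by rewrite DM der_inverse big_split /= mulNr mulrDl !mulr_suml [LHS]addrC.
Qed.

Lemma cd4_contr T e c d :
  cd2 (fun c d => contr (fun a b => T a b c d)) e c d
  = contr (fun a b => cd4 T e a b c d).
Proof.
rewrite /cd2 der_contr big_split /= opprD.
rewrite [RHS](eq_contr (T' := fun a b => cd2 (fun a b => T a b c d) e a b
  + (- (\sum_f chr f c e * T a b f d) - \sum_f chr f d e * T a b c f))); last first.
  by move=> a b; rewrite /cd4 /cd2 !big_split /=; ring.
rewrite !contrD !contrN !contr_sum; congr (_ + (- _ - _)).
  by apply: eq_bigr => f _; rewrite contrZ.
by apply: eq_bigr => f _; rewrite contrZ.
Qed.

Lemma eq_cd2 T T' e a b : T =2 T' -> cd2 T e a b = cd2 T' e a b.
Proof.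
by move=> E; rewrite /cd2 E; congr (_ - _); apply: eq_bigr => f _; rewrite !E.
Qed.

Lemma cd2_sym T e a b : (forall x y, T x y = T y x) -> cd2 T e a b = cd2 T e b a.
Proof.
move=> sT; rewrite /cd2 sT; congr (_ - _); apply: eq_bigr => f _.
by rewrite addrC (sT a) (sT f b).
Qed.

Lemma cd2N T e a b : cd2 (fun a b => - T a b) e a b = - cd2 T e a b.
Proof.
rewrite /cd2 derN [RHS]opprD; congr (_ + - _); rewrite -sumrN.
by apply: eq_bigr => f _; rewrite !mulrN opprD.
Qed.

Definition ric a b : A := \sum_c rmu c a c b.

Definition scal : A := \sum_a \sum_b Gi a b * ric a b.

Lemma contr_rm b d : contr (fun a c => rm a b c d) = ric b d.
Proof.
rewrite -contrC /contr /ric; apply: eq_bigr => c _.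
rewrite -[RHS](sum_delta (fun e => rmu e b c d) c).
under eq_bigr do rewrite /rm mulr_sumr.
rewrite exchange_big /=; apply: eq_bigr => e _.
by rewrite eq_sym -mulGiG mulr_suml; apply: eq_bigr => a _; rewrite mulrA.
Qed.

Lemma ric_sym b d : ric b d = ric d b.
Proof.
rewrite -!contr_rm -[RHS]contrC; apply: eq_contr => a c.
by rewrite rm_pair.
Qed.

Lemma contr_rm14 b d : contr (fun a c => rm a b d c) = - ric b d.
Proof. by rewrite -contr_rm -contrN; apply: eq_contr => a c; rewrite rm_asym34. Qed.

Lemma contr_rm24 a c : contr (fun b d => rm a b c d) = ric a c.
Proof.
rewrite -contr_rm; apply: eq_contr => b d.
by rewrite rm_asym12 rm_asym34 opprK.
Qed.

Lemma div_rm b c d :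
  contr (fun e a => cd4 rm e a b c d) = cd2 ric c b d - cd2 ric d b c.
Proof.
have -> : contr (fun e a => cd4 rm e a b c d) =
    contr (fun e a => - cd4 rm c a b d e + - cd4 rm d a b e c).
  apply: eq_contr => e a; apply/eqP; rewrite -subr_eq0; apply/eqP.
  by rewrite -[RHS](rm_bianchi e a b c d); ring.
have E1 : contr (fun e a => cd4 rm c a b d e) = - cd2 ric c b d.
  rewrite -cd2N.
  transitivity (cd2 (fun b d => contr (fun e a => rm a b d e)) c b d).
    rewrite (cd4_contr (fun e a b d => rm a b d e)).
    apply: eq_contr => e a; rewrite /cd4; congr (_ - _).
    by apply: eq_bigr => f _; ring.
  by apply: eq_cd2 => x y; rewrite -contrC contr_rm14.
have E2 : contr (fun e a => cd4 rm d a b e c) = cd2 ric d b c.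
  transitivity (cd2 (fun b c => contr (fun e a => rm a b e c)) d b c).
    rewrite (cd4_contr (fun e a b c => rm a b e c)).
    apply: eq_contr => e a; rewrite /cd4; congr (_ - _).
    by apply: eq_bigr => f _; ring.
  by apply: eq_cd2 => x y; rewrite -contrC contr_rm.
by rewrite contrD !contrN E1 E2 opprK.
Qed.

(** Contracting [div_rm] once more reproduces the divergence of Ricci on the right with a minus
    sign, whence the factor 2. *)
Lemma div_ric c : 2 * contr (fun e a => cd2 ric e a c) = D c scal.
Proof.
have E : contr (fun e a => cd2 ric e a c)
    = contr (fun b d => contr (fun e a => cd4 rm e a b c d)).
  rewrite contr_contr; apply: eq_contr => e a.
  transitivity (cd2 (fun a c => contr (fun b d => rm a b c d)) e a c).
    by apply: eq_cd2 => x y; rewrite contr_rm24.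
  rewrite (cd4_contr (fun b d a c => rm a b c d)).
  apply: eq_contr => b d; rewrite /cd4; congr (_ - _).
  by apply: eq_bigr => f _; ring.
rewrite mulr_natl mulr2n {1}E.
under eq_contr do rewrite div_rm.
rewrite contrD contrN -[D c scal]/(D c (contr ric)) der_contr.
rewrite [contr (fun a b => cd2 ric b a c)]contrC addrNK; apply: eq_contr => a b.
by [].
Qed.

Definition sch a b : A := half * ric a b - twelfth * scal * G a b.

Lemma sch_sym a b : sch a b = sch b a.
Proof. by rewrite /sch ric_sym Gsym. Qed.

Definition weyl_tensor a b c d : A :=
  rm a b c d + G a d * sch c b - G a c * sch d b + G b c * sch d a - G b d * sch c a.

Lemma weyl_asym12 a b c d : weyl_tensor b a c d = - weyl_tensor a b c d.
Proof. by rewrite /weyl_tensor rm_asym12; ring. Qed.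

Lemma weyl_asym34 a b c d : weyl_tensor a b d c = - weyl_tensor a b c d.
Proof. by rewrite /weyl_tensor rm_asym34; ring. Qed.

Lemma weyl_pair a b c d : weyl_tensor c d a b = weyl_tensor a b c d.
Proof.
rewrite /weyl_tensor (rm_pair c d) (Gsym c) (Gsym c) (Gsym d a) (Gsym d b).
by rewrite (sch_sym a d) (sch_sym b d) (sch_sym a c) (sch_sym b c); ring.
Qed.

Lemma weyl_cycle a b c d :
  weyl_tensor a b c d + weyl_tensor a c d b + weyl_tensor a d b c = 0.
Proof.
rewrite -[RHS](rm_cycle a b c d) /weyl_tensor.
rewrite (Gsym c b) (Gsym d b) (Gsym d c) (sch_sym c b) (sch_sym d b) (sch_sym d c).
rewrite (sch_sym c a) (sch_sym d a) (sch_sym b a).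
by ring.
Qed.

Lemma contr_GG : contr G = 4.
Proof.
transitivity (\sum_(a < 4) (1 : A)); last by rewrite sumr_const card_ord.
apply: eq_bigr => a _; transitivity ((a == a)%:R : A); last by rewrite eqxx.
rewrite -mulGiG.
by apply: eq_bigr => b _; rewrite Gsym.
Qed.

(** In dimension 4 the trace of the Schouten terms is minus (2 P + (tr P) G), and tr P = [scal] / 6
    makes 2 P + (tr P) G equal to the Ricci tensor. *)
Lemma weyl_trace b d : contr (fun a c => weyl_tensor a b c d) = 0.
Proof.
have t1 : contr (fun a c => G a d * sch c b) = sch d b.
  by rewrite -contrC contr_metric.
have t2 : contr (fun a c => G b c * sch d a) = sch d b.
  by rewrite -[RHS](contr_metric b (sch d)); apply: eq_contr => a c; rewrite Gsym.
have trP : contr sch = 2 * twelfth * scal.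
  rewrite contrD contrN !contrZ contr_GG -[contr ric]/scal.
  by rewrite half_twelfth; ring.
rewrite 4!contrD 2!contrN contr_rm t1 t2.
under [X in _ - X + _ - _]eq_bigr do under eq_bigr do rewrite [G _ _ * _]mulrC.
rewrite -/(contr (fun a c => sch d b * G a c)) !contrZ.
under [X in _ - _ * X]eq_bigr do under eq_bigr do rewrite sch_sym.
rewrite -/(contr sch) trP contr_GG /sch (ric_sym d) (Gsym d).
transitivity (ric b d - half * 2 * ric b d); first by ring.
by rewrite half2 mul1r subrr.
Qed.

Lemma cd2_sch e a b :
  cd2 sch e a b = half * cd2 ric e a b - twelfth * D e scal * G a b.
Proof.
have DG : D e (G a b) = \sum_f (chr f a e * G f b + chr f b e * G a f).
  exact: der_metric.
have E : \sum_f (chr f a e * sch f b + chr f b e * sch a f)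
  = half * \sum_f (chr f a e * ric f b + chr f b e * ric a f)
    - twelfth * scal * \sum_f (chr f a e * G f b + chr f b e * G a f).
  rewrite /sch; move: scal => s.
  by rewrite !mulr_sumr -sumrB; apply: eq_bigr => f _; ring.
rewrite /cd2 E /sch derB !DM (der_inv_nat e half2) (der_inv_nat e twelfth12) DG.
by ring.
Qed.

Lemma cd4_weyl e a b c d : cd4 weyl_tensor e a b c d =
  cd4 rm e a b c d + G a d * cd2 sch e c b - G a c * cd2 sch e d b
  + G b c * cd2 sch e d a - G b d * cd2 sch e c a.
Proof.
have DG x y : D e (G x y) = \sum_f (chr f x e * G f y + chr f y e * G x f).
  exact: der_metric.
rewrite /cd4 /cd2 /weyl_tensor !(DD, derN, DM) !DG.
rewrite !big_ord_recl !big_ord0.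
by ring.
Qed.

Lemma contr_cd2_sch d : contr (fun e a => cd2 sch e d a) = 2 * twelfth * D d scal.
Proof.
have C1 : contr (fun e a => cd2 ric e d a) = half * D d scal.
  rewrite -div_ric mulrA half2 mul1r; apply: eq_contr => e a.
  exact: cd2_sym ric_sym.
under eq_contr do rewrite cd2_sch.
rewrite contrD contrN contrZ C1.
under eq_contr do rewrite -mulrA (Gsym d).
rewrite contrZ; under eq_contr do rewrite mulrC.
rewrite contr_metric half_twelfth.
(* Both factors [half] have become [6 * twelfth]; the arithmetic is 1/4 - 1/12 = 2/12. *)
transitivity (36 * twelfth * twelfth * D d scal - twelfth * D d scal); first by ring.
transitivity (3 * (twelfth * 12) * twelfth * D d scal - twelfth * D d scal); first by ring.
by rewrite twelfth12; ring.
Qed.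

(** In dimension n the divergence of the Weyl tensor is n - 3 times the Cotton tensor; the factor is
    1 here. The gradients of the scalar curvature cancel. *)
Theorem div_weyl b c d :
  contr (fun e a => cd4 weyl_tensor e a b c d) = cd2 sch c d b - cd2 sch d c b.
Proof.
under eq_contr do rewrite cd4_weyl.
rewrite 4!contrD 2!contrN div_rm !contr_metric !contrZ !contr_cd2_sch.
rewrite !cd2_sch !(cd2_sym _ _ b ric_sym) (Gsym d) (Gsym c).
transitivity ((half * 2) * cd2 ric c b d - (half * 2) * cd2 ric d b c
  - half * cd2 ric c b d + half * cd2 ric d b c - twelfth * D c scal * G b d
  + twelfth * D d scal * G b c); last by ring.
by rewrite half2 !mul1r; ring.
Qed.

(** [K] collects the connection terms of the slots already processed, so that the Leibniz rule can
    be iterated one slot after another without knowing the total number of slots. *)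
Lemma der_ev1 (K : 'I_4 -> 'I_4 -> A) u T e :
  D e (ev1 u T) - \sum_f ev1 u (K f) = ev1 (cd1 u e) T
  + ev1 u (fun a => D e (T a) - \sum_f (K f a + chr f a e * T f)).
Proof.
rewrite der_sum [LHS](_ : _ = \sum_a (D e (u a) * T a + u a * D e (T a)
    - \sum_f u a * K f a)
  + (\sum_a \sum_f chr a f e * u f * T a - \sum_a \sum_f chr f a e * u a * T f)).
  rewrite -big_split -sumrB -big_split; apply: eq_bigr => a _ /=.
  rewrite /cd1 big_split /= mulrDl mulr_suml mulrBr mulrDr !mulr_sumr.
  have -> : \sum_f u a * (chr f a e * T f) = \sum_f chr f a e * u a * T f.
    by apply: eq_bigr => f _; ring.
  by ring.
rewrite [X in _ + (X - _)]exchange_big /= subrr addr0.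
rewrite sumrB [X in _ = _ - X]exchange_big; congr (_ - _).
by apply: eq_bigr => a _; rewrite DM.
Qed.

Lemma der_ev2 T u v e :
  D e (ev2 T u v) = ev2 (cd2 T e) u v + ev2 T (cd1 u e) v + ev2 T u (cd1 v e).
Proof.
have := der_ev1 (fun=> fun=> 0) u (fun a => ev1 v (T a)) e.
rewrite [X in _ - X]big1 ?subr0 => [->|f _]; last first.
  by apply: big1 => a _; rewrite mulr0.
rewrite /ev2 addrC addrAC; congr (_ + _); rewrite -ev1D.
apply: eq_ev1 => // a; under eq_bigr do rewrite add0r ev1Z.
rewrite der_ev1 addrC; congr (_ + _); exact: eq_ev1.
Qed.

Lemma der_ev4 T u v w z e :
  D e (ev4 T u v w z) = ev4 (cd4 T e) u v w z
  + ev4 T (cd1 u e) v w z + ev4 T u (cd1 v e) w z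
  + ev4 T u v (cd1 w e) z + ev4 T u v w (cd1 z e).
Proof.
have := der_ev1 (fun=> fun=> 0) u (fun a => ev1 v (fun b => ev2 (T a b) w z)) e.
rewrite [X in _ - X]big1 ?subr0 => [->|f _]; last first.
  by apply: big1 => a _; rewrite mulr0.
rewrite -/(ev4 T (cd1 u e) v w z) [X in X + _ + _ + _]addrC -!addrA.
congr (_ + _); rewrite /ev4 -!ev1D; apply: eq_ev1 => // a.
under eq_bigr do rewrite add0r ev1Z.
rewrite der_ev1 addrCA; congr (_ + _); rewrite -!ev1D; apply: eq_ev1 => // b.
rewrite /ev2; under eq_bigr do rewrite !ev1Z -ev1D.
rewrite der_ev1 addrCA; congr (_ + _); rewrite -!ev1D; apply: eq_ev1 => // c.
under eq_bigr do rewrite !ev1Z -!ev1D.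
by rewrite der_ev1 addrC; congr (_ + _); exact: eq_ev1.
Qed.

Definition bracket u v a : A := \sum_b (u b * D b (v a) - v b * D b (u a)).

(** Absence of torsion: the Christoffel terms are symmetric in their lower indices and drop out of
    the difference. *)
Lemma bracketE u v a :
  bracket u v a = \sum_b (u b * cd1 v b a - v b * cd1 u b a).
Proof.
rewrite [RHS](_ : _ = bracket u v a
  + (\sum_b \sum_f chr a f b * v f * u b - \sum_b \sum_f chr a f b * u f * v b)).
  rewrite [X in _ + (X - _)]exchange_big /=.
  rewrite [X in _ + (X - _)](_ : _ = \sum_b \sum_f chr a f b * u f * v b) ?subrr ?addr0//.
  by apply: eq_bigr => b _; apply: eq_bigr => f _; rewrite chr_sym; ring.
rewrite -sumrB -big_split; apply: eq_bigr => b _ /=.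
rewrite /cd1 !mulrDr !mulr_sumr.
have E (x : A) (y : 'I_4 -> A) : \sum_f x * (chr a f b * y f) = \sum_f chr a f b * y f * x.
  by apply: eq_bigr => f _; ring.
by rewrite !E; ring.
Qed.

End AbstractCurvature.

(** * Algebra of the Weyl tensor in a null frame *)

Section WeylForm.
Variables (K : numFieldType) (V : lmodType K) (C : V -> V -> V -> V -> K).

(** Linearity is required in the first slot only; the symmetries carry it to the other three. *)
Record curvature_form : Prop := CurvatureForm {
  form_lin : forall a x x' y z w, C (a *: x + x') y z w = a * C x y z w + C x' y z w;
  form_asym12 : forall x y z w, C y x z w = - C x y z w;
  form_asym34 : forall x y z w, C x y w z = - C x y z w;
  form_pair : forall x y z w, C z w x y = C x y z w;
  form_cycle : forall x y z w, C x y z w + C x z w y + C x w y z = 0 }.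

(** In a null frame the inverse metric is mp + pm + nk + kn; this is the trace over the first and
    third slots. *)
Definition trace_free m p n k :=
  forall x y, C m x p y + C p x m y + C n x k y + C k x n y = 0.

Hypothesis hC : curvature_form.

Lemma formD x x' y z w : C (x + x') y z w = C x y z w + C x' y z w.
Proof. by rewrite -[x]scale1r (form_lin hC) mul1r scale1r. Qed.

Lemma form0 y z w : C 0 y z w = 0.
Proof. by apply: (@addrI _ (C 0 y z w)); rewrite -formD !addr0. Qed.

Lemma formZ a x y z w : C (a *: x) y z w = a * C x y z w.
Proof. by rewrite -[a *: x]addr0 (form_lin hC) form0 addr0. Qed.

Lemma formN x y z w : C (- x) y z w = - C x y z w.
Proof. by rewrite -scaleN1r formZ mulN1r. Qed.

Lemma formD2 x y y' z w : C x (y + y') z w = C x y z w + C x y' z w.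
Proof. by rewrite (form_asym12 hC) formD opprD -!(form_asym12 hC). Qed.

Lemma formZ2 a x y z w : C x (a *: y) z w = a * C x y z w.
Proof. by rewrite (form_asym12 hC) formZ -mulrN -(form_asym12 hC). Qed.

Lemma formN2 x y z w : C x (- y) z w = - C x y z w.
Proof. by rewrite -scaleN1r formZ2 mulN1r. Qed.

Lemma formD3 x y z z' w : C x y (z + z') w = C x y z w + C x y z' w.
Proof. by rewrite (form_pair hC) formD !(form_pair hC x). Qed.

Lemma formZ3 a x y z w : C x y (a *: z) w = a * C x y z w.
Proof. by rewrite (form_pair hC) formZ (form_pair hC x). Qed.

Lemma formN3 x y z w : C x y (- z) w = - C x y z w.
Proof. by rewrite -scaleN1r formZ3 mulN1r. Qed.

Lemma formD4 x y z w w' : C x y z (w + w') = C x y z w + C x y z w'.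
Proof. by rewrite (form_pair hC) formD2 !(form_pair hC x). Qed.

Lemma formZ4 a x y z w : C x y z (a *: w) = a * C x y z w.
Proof. by rewrite (form_pair hC) formZ2 (form_pair hC x). Qed.

Lemma formN4 x y z w : C x y z (- w) = - C x y z w.
Proof. by rewrite -scaleN1r formZ4 mulN1r. Qed.

Definition formE := (formD, formZ, formN, formD2, formZ2, formN2,
  formD3, formZ3, formN3, formD4, formZ4, formN4).

Lemma double_eq0 (x : K) : x + x = 0 -> x = 0.
Proof. by move=> /eqP; rewrite -mulr2n mulrn_eq0 => /eqP. Qed.

(** Linear elimination: [c] is the multiple of the relation [e = 0] to be used, and [ring] or
    [field] checks the rest. *)
Lemma eq_of_relation (c x y e : K) : e = 0 -> x - y = c * e -> x = y.
Proof. by move=> -> /eqP; rewrite mulr0 subr_eq0 => /eqP. Qed.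

Lemma form_xx12 x z w : C x x z w = 0.
Proof.
by apply: double_eq0; rewrite {1}(form_asym12 hC) addNr.
Qed.

Lemma form_xx34 x z w : C z w x x = 0.
Proof. by rewrite -(form_pair hC) form_xx12. Qed.

Section Frame.
Variables m p n k : V.
Hypothesis tr : trace_free m p n k.

(* Rewrites every component in the frame to one whose index pairs belong to
   mp, mn, mk, pn, pk, nk and come in this order. *)
Definition frameE := (
  (form_xx12 m, form_xx12 p, form_xx12 n, form_xx12 k,
   form_xx34 m, form_xx34 p, form_xx34 n, form_xx34 k),
  (form_asym12 hC m p, form_asym12 hC m n, form_asym12 hC m k,
   form_asym12 hC p n, form_asym12 hC p k, form_asym12 hC n k),
  (fun x y => (form_asym34 hC x y m p, form_asym34 hC x y m n, form_asym34 hC x y m k,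
   form_asym34 hC x y p n, form_asym34 hC x y p k, form_asym34 hC x y n k)),
  (form_pair hC m p m n, form_pair hC m p m k, form_pair hC m p p n,
   form_pair hC m p p k, form_pair hC m p n k),
  (form_pair hC m n m k, form_pair hC m n p n, form_pair hC m n p k,
   form_pair hC m n n k, form_pair hC m k p n, form_pair hC m k p k,
   form_pair hC m k n k),
  (form_pair hC p n p k, form_pair hC p n n k, form_pair hC p k n k)).

(** A pair-symmetric form has 21 components in a frame. The ten traces and one cyclic identity
    eliminate eleven of them; the ten that remain are the five Psi and their five antiselfdual
    counterparts. *)
Lemma frame_traces :
  [/\ C m n m k = 0, C m k p k = 0, C m p m k = - C m k n k,
      C m n p n = 0 & C p n p k = 0]
  /\ [/\ C m p m p = C m n p k + C m k p n, C m p m n = C m n n k,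
      C m p p n = - C p n n k, C m p p k = C p k n k
    & C n k n k = C m n p k + C m k p n]
  /\ C m p n k = C m n p k - C m k p n.
Proof.
have := tr m m; rewrite !frameE !opprK !add0r => /double_eq0 ->.
have := tr k k; rewrite !frameE !addr0 => /double_eq0 ->.
have := tr p p; rewrite !frameE !opprK !add0r => /double_eq0 ->.
have := tr n n; rewrite !frameE !addr0 => /double_eq0 ->.
have := tr m p; rewrite !frameE => /eqP; rewrite -subr_eq0 => /eqP Tmp.
have := tr m n; rewrite !frameE => Tmn; have := tr m k; rewrite !frameE => Tmk.
have := tr p n; rewrite !frameE => Tpn; have := tr p k; rewrite !frameE => Tpk.
have := tr n k; rewrite !frameE => Tnk.
have := form_cycle hC m p n k; rewrite !frameE => B.
split; first by split => //; apply: (eq_of_relation (c := -1) Tmk); ring.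
split; last by apply: (eq_of_relation (c := 1) B); ring.
split.
- by apply: (eq_of_relation (c := -1) Tmp); ring.
- by apply: (eq_of_relation (c := -1) Tmn); ring.
- by apply: (eq_of_relation (c := 1) Tpn); ring.
- by apply: (eq_of_relation (c := 1) Tpk); ring.
- by apply: (eq_of_relation (c := -1) Tnk); ring.
Qed.

(* The component along [span(m + t n, k - t p)] is the quartic of the context,
   and the next one a quarter of its derivative. *)
Lemma form_rotated t :
  C (m + t *: n) (k - t *: p) (m + t *: n) (k - t *: p)
  = C p n p n * t ^+ 4 - 4 * C p n m p * t ^+ 3 + 6 * C m k p n * t ^+ 2
    + 4 * C m k n k * t + C m k m k
  /\ C (m + t *: n) (k - t *: p) n (k - t *: p)
  = C p n p n * t ^+ 3 - 3 * C p n m p * t ^+ 2 + 3 * C m k p n * t + C m k n k.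
Proof.
have [[E1 E2 E3 E4 E5] [[E6 E7 E8 E9 E10] E11]] := frame_traces.
by split; rewrite !formE !frameE ?E1 ?E2 ?E3 ?E4 ?E5 ?E6 ?E7 ?E8 ?E9 ?E10 ?E11; ring.
Qed.

Hypothesis span : forall v, exists a b c d,
  v = a *: m + b *: p + c *: n + d *: k.

(* Vanishing of [Psi0], ..., [Psi4] leaves only the antiselfdual components. *)
Lemma form_selfdual_part0 x y :
  C m k m k = 0 -> C m k n k = 0 -> C m k p n = 0 -> C p n m p = 0 ->
  C p n p n = 0 ->
  [/\ C m k x y = 0, C p n x y = 0 & C m p x y = C n k x y].
Proof.
have [[E1 E2 E3 E4 E5] [[E6 E7 E8 E9 E10] E11]] := frame_traces.
rewrite !frameE => P0 P1 P2 P3 P4; have := E8; rewrite P3 => /esym/eqP.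
rewrite oppr_eq0 => /eqP E8'.
have [a [b [c [d ->]]]] := span x; have [a' [b' [c' [d' ->]]]] := span y.
split; rewrite !formE !frameE ?E1 ?E2 ?E3 ?E4 ?E5 ?E6 ?E7 ?E9 ?E10 ?E11
  ?P0 ?P1 ?P2 ?P3 ?P4 ?E8'; ring.
Qed.

Hypothesis Psi0 : C m k m k = 0.
Hypothesis Psi1 : C m k n k = 0.

(** By the trace relations every component of C(m, k, ., .) is zero or, up to sign, one of Psi0,
    Psi1, Psi2; Psi2 occurs only with p and n together, never with m or k in the third slot. *)
Lemma form_aligned v : C m k m v = 0 /\ C m k k v = 0.
Proof.
have [[E1 E2 E3 E4 E5] [[E6 E7 E8 E9 E10] E11]] := frame_traces.
have [a [b [c [d ->]]]] := span v.
by rewrite !formE !frameE ?E1 ?E2 ?E3 Psi0 Psi1; split; ring.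
Qed.

Lemma form_aligned_Psi2 u v : C m k p n = 0 -> C u v m k = 0.
Proof.
have [[E1 E2 E3 E4 E5] [[E6 E7 E8 E9 E10] E11]] := frame_traces.
move=> P2; have [a [b [c [d ->]]]] := span u; have [a' [b' [c' [d' ->]]]] := span v.
by rewrite !formE !frameE ?E1 ?E2 ?E3 Psi0 Psi1 P2; ring.
Qed.

(** * The divergence identity in a null frame; [dm], [dk], [nC] play the covariant derivatives of m,
    k and C *)

Section Divergence.
Variables (dm dk : V -> V) (nC : V -> V -> V -> V -> V -> K) (sigma : V -> K).
Hypothesis dmE : forall v, exists a b, dm v = a *: m + b *: k + sigma v *: n.
Hypothesis dkE : forall v, exists a b, dk v = a *: m + b *: k - sigma v *: p.
Hypothesis div0 : forall y,
  nC m p y m k + nC p m y m k + nC n k y m k + nC k n y m k = 0.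

(** With m as free argument, the divergence contains sigma at m, p, n and k. The trace relations
    together with Psi0 = Psi1 = 0 kill the last three coefficients, and that of sigma(m) is -3
    Psi2. *)
Lemma sigma_Psi2 :
  (forall v u, nC v u m m k + C u (dm v) m k + C u m (dm v) k + C u m m (dk v) = 0) ->
  sigma m * C m k p n = 0.
Proof.
move=> dC; have := div0 m.
have [[E1 E2 E3 E4 E5] [[E6 E7 E8 E9 E10] E11]] := frame_traces.
(* The components of [dm v] and [dk v] inside the plane only produce values of C with three
   arguments in the plane, which vanish; only [sigma v] survives. *)
have step v u : nC v u m m k = - sigma v * (C u n m k + C u m n k - C u m m p).
  have [a [b dmv]] := dmE v; have [a' [b' dkv]] := dkE v.
  apply: (eq_of_relation (c := 1) (dC v u)); rewrite dmv dkv !formE !form_xx34.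
  have -> : C u m m k = - C m k m u by rewrite -(form_pair hC) (form_asym34 hC).
  have -> : C u k m k = - C m k k u by rewrite -(form_pair hC) (form_asym34 hC).
  by have [-> ->] := form_aligned u; ring.
rewrite !step !frameE ?E1 ?E2 ?E3 ?E6 ?E7 ?E11 ?Psi1 ?Psi0 => E.
by apply: (eq_of_relation (c := - 3^-1) E); field.
Qed.

(** With n as free argument and Psi2 = 0, the coefficients of sigma at p, n and k vanish again, and
    that of sigma(m) is 2 Psi3, since C(p, n, n, k) = - Psi3. *)
Lemma sigma_Psi3 : C m k p n = 0 ->
  (forall v u y, nC v u y m k + C u y (dm v) k + C u y m (dk v) = 0) ->
  sigma m * C p n m p = 0.
Proof.
move=> P2 dC; have := div0 n.
have [[E1 E2 E3 E4 E5] [[E6 E7 E8 E9 E10] E11]] := frame_traces.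
have step v u y : nC v u y m k = - sigma v * (C u y n k - C u y m p).
  have [a [b dmv]] := dmE v; have [a' [b' dkv]] := dkE v.
  apply: (eq_of_relation (c := 1) (dC v u y)).
  rewrite dmv dkv !formE !form_xx34 (form_aligned_Psi2 _ _ P2).
  by ring.
rewrite !step !frameE ?E1 ?E2 ?E3 ?E4 ?E5 ?E6 ?E7 ?E8 ?E9 ?E10 ?E11 P2.
by move=> E; apply: (eq_of_relation (c := 2^-1) E); field.
Qed.
End Divergence.
End Frame.

Section Swap.
Variables (m p n k : V) (dm dk : V -> V) (nC : V -> V -> V -> V -> V -> K).
Variable sigma : V -> K.
Hypothesis tr : trace_free m p n k.
Hypothesis span : forall v, exists a b c d,
  v = a *: m + b *: p + c *: n + d *: k.
Hypothesis Psi0 : C m k m k = 0.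
Hypothesis Psi1 : C m k n k = 0.
Hypothesis dmE : forall v, exists a b, dm v = a *: m + b *: k + sigma v *: n.
Hypothesis dkE : forall v, exists a b, dk v = a *: m + b *: k - sigma v *: p.
Hypothesis div0 : forall y,
  nC m p y m k + nC p m y m k + nC n k y m k + nC k n y m k = 0.
Hypothesis div0' : forall y,
  nC m p y k m + nC p m y k m + nC n k y k m + nC k n y k m = 0.

(* The frame [k, n, p, m] is null as well and has the same plane [span(m, k)]. *)
Lemma trace_free_swap : trace_free k n p m.
Proof. by move=> x y; rewrite -[RHS](tr x y); ring. Qed.

Lemma span_swap v : exists a b c d, v = a *: k + b *: n + c *: p + d *: m.
Proof.
have [a [b [c [d ->]]]] := span v; exists d, c, b, a.
by rewrite [LHS]addrC [X in _ + X]addrC [X in _ + (_ + X)]addrC !addrA.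
Qed.

Lemma Psi0_swap : C k m k m = 0.
Proof. by rewrite (form_asym12 hC) (form_asym34 hC) Psi0 !oppr0. Qed.

Lemma Psi1_swap : C k m p m = 0.
Proof.
have [[_ _ E _ _] _] := frame_traces tr.
by rewrite (form_asym12 hC) (form_asym34 hC) (form_pair hC) E Psi1 !oppr0.
Qed.

Lemma dmE_swap v : exists a b, dk v = a *: k + b *: m + (- sigma v) *: p.
Proof. by have [a [b ->]] := dkE v; exists b, a; rewrite (addrC (b *: k)) scaleNr. Qed.

Lemma dkE_swap v : exists a b, dm v = a *: k + b *: m - (- sigma v) *: n.
Proof. by have [a [b ->]] := dmE v; exists b, a; rewrite (addrC (b *: k)) scaleNr opprK. Qed.

Lemma div0_swap y : nC k n y k m + nC n k y k m + nC p m y k m + nC m p y k m = 0.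
Proof. by rewrite -[RHS](div0' y); ring. Qed.

(** The value at k is the value at m for the exchanged frame, where sigma changes sign and Psi2 does
    not. As [nC] is an arbitrary function here, the exchanged divergence identity [div0'] is a
    separate hypothesis. *)
Lemma sigma_Psi2_plane :
  (forall v u, nC v u m m k + C u (dm v) m k + C u m (dm v) k + C u m m (dk v) = 0) ->
  (forall v u, nC v u k k m + C u (dk v) k m + C u k (dk v) m + C u k k (dm v) = 0) ->
  sigma m * C m k p n = 0 /\ sigma k * C m k p n = 0.
Proof.
move=> dC dC'; split; first exact: (sigma_Psi2 tr span Psi0 Psi1 dmE dkE div0).
have := sigma_Psi2 trace_free_swap span_swap Psi0_swap Psi1_swap dmE_swap dkE_swap
  div0_swap dC'.
by rewrite (form_asym12 hC) (form_asym34 hC) opprK mulNr => /eqP; rewrite oppr_eq0 => /eqP.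
Qed.

Lemma sigma_Psi3_plane : C m k p n = 0 ->
  (forall v u y, nC v u y m k + C u y (dm v) k + C u y m (dk v) = 0) ->
  (forall v u y, nC v u y k m + C u y (dk v) m + C u y k (dm v) = 0) ->
  sigma m * C p n m p = 0 /\ sigma k * C p n m p = 0.
Proof.
move=> P2 dC dC'; split.
  exact: (sigma_Psi3 tr span Psi0 Psi1 dmE dkE div0 P2 dC).
have P2' : C k m n p = 0 by rewrite (form_asym12 hC) (form_asym34 hC) opprK.
have := sigma_Psi3 trace_free_swap span_swap Psi0_swap Psi1_swap dmE_swap dkE_swap
  div0_swap P2' dC'.
(* The Psi3 of the exchanged frame is [C n p k n], which the trace relation turns into
   [- C p n m p]; this sign meets the one of sigma. *)
have [_ [[_ _ E _ _] _]] := frame_traces tr.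
have -> : C n p k n = C p n n k by rewrite (form_asym12 hC) (form_asym34 hC) opprK.
by rewrite (form_pair hC m p p n) E mulNr mulrN.
Qed.

End Swap.
End WeylForm.

(** * Smooth functions *)

Section Calculus.
Context {R : realType} {E : normedModType R}.
Implicit Types (f g : E -> R^o) (x v w : E).

Lemma differentiable_expansion f x : differentiable f x ->
  forall eps, 0 < eps ->
    \forall h \near 0, `|f (h + x) - (f x + 'd f x h)| <= eps * `|h|.
Proof. by move=> /diff_locally /eqaddoP fo eps eps0; exact: fo. Qed.

Lemma near_eq_differentiable f g x :
  (\forall z \near x, f z = g z) -> differentiable f x -> differentiable g x.
Proof.
move=> fg df; have [dc /eqaddoP fo] := (diff_locallyP _ _).1 df.
have go : g \o shift x = cst (g x) + 'd f x +o_ 0 id.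
  apply/eqaddoP => eps eps0.
  have H : \forall h \near 0, f (h + x) = g (h + x).
    rewrite (near_shift x) /=; apply: filterS fg => z.
    by rewrite /= sub0r subrK.
  apply: filterS2 H (fo _ eps0) => h /= E1.
  by rewrite !fctE /= E1 (nbhs_singleton fg).
apply/diff_locallyP; suff -> : 'd g x = 'd f x :> (E -> R^o) by [].
exact: diff_unique.
Qed.

Lemma is_derive_line f x v t : derivable f (t *: v + x) v ->
  is_derive t 1 (fun s : R => f (s *: v + x)) ('D_v f (t *: v + x)).
Proof.
move=> df.
have E1 : (fun h : R => h^-1 *: (((fun s : R => f (s *: v + x)) \o shift t) (h *: (1 : R))
      - f (t *: v + x)))
    = (fun h => h^-1 *: ((f \o shift (t *: v + x)) (h *: v) - f (t *: v + x))).
  apply/funext => h /=; congr (_ *: (f _ - _)).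
  by rewrite [h *: 1]mulr1 scalerDl addrA.
by split; rewrite /derivable /derive E1.
Qed.

(** The mean value theorem in direction [v], applied to the increment of [f] along [h *: w], reduces
    the second difference to values of 'D_v f; these are then expanded to first order at [x], so
    differentiability of 'D_v f is needed at [x] only. *)
Lemma second_difference f v w x :
  (\forall z \near x, derivable f z v) -> differentiable ('D_v f) x ->
  forall eps, 0 < eps -> exists2 d, 0 < d & forall h, 0 < h < d ->
    `|f (h *: v + (h *: w + x)) - f (h *: v + x) - f (h *: w + x) + f x
      - h ^+ 2 * 'D_w ('D_v f) x| <= eps * h ^+ 2.
Proof.
move=> dvf dg eps eps0; set g := 'D_v f; set L := 'd g x.
have -> : 'D_w g x = L w by exact: deriveE.
(* All points used lie within [h * M] of [x]; the added 1 keeps [M] positive. Two expansion errors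
   occur, hence the tolerance [eps / (2 * M)]. *)
set M := `|v| + `|w| + 1; have M0 : 0 < M by rewrite ltr_wpDl// addr_ge0.
have e0 : 0 < eps / (2 * M) by rewrite divr_gt0// mulr_gt0.
have /nbhs_ballP[d1 /= d10 hd1] := differentiable_expansion dg e0.
have /nbhs_ballP[d2 /= d20 hd2] := dvf.
set d := Num.min d1 d2; have d0 : 0 < d by rewrite lt_min d10 d20.
exists (d / M); first by rewrite divr_gt0.
move=> h /andP[h0 hd].
have small s t : 0 <= s <= h -> 0 <= t <= h ->
    `|s *: v + t *: w| <= h * M /\ `|s *: v + t *: w| < d.
  move=> /andP[s0 sh] /andP[t0 th].
  have le : `|s *: v + t *: w| <= h * M.
    rewrite (le_trans (ler_normD _ _))// !normrZ !ger0_norm// /M !mulrDr.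
    by rewrite ler_wpDr ?mulr1 ?(ltW h0)// lerD// ler_wpM2r.
  by split => //; rewrite (le_lt_trans le)// -ltr_pdivlMr.
have exp u : `|u| < d -> `|g (u + x) - (g x + L u)| <= eps / (2 * M) * `|u|.
  move=> ud; apply: hd1; rewrite -ball_normE /= sub0r normrN.
  by rewrite (lt_le_trans ud)// ge_min lexx.
have der u : `|u| < d -> derivable f (u + x) v.
  move=> ud; apply: hd2; rewrite -ball_normE /= opprD addrCA subrr addr0 normrN.
  by rewrite (lt_le_trans ud)// ge_min lexx orbT.
have h0h : 0 <= h <= h by rewrite lexx ltW.
have z0h : 0 <= (0 : R) <= h by rewrite lexx ltW.
pose phi s : R := f (s *: v + (h *: w + x)) - f (s *: v + x).
have dphi s : 0 <= s <= h ->
    is_derive s 1 phi (g (s *: v + (h *: w + x)) - g (s *: v + x)).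
  move=> sh; apply: is_deriveB; apply: is_derive_line.
    by rewrite addrA; apply: der; have [] := small s h sh h0h.
  by apply: der; have [] := small s 0 sh z0h; rewrite scale0r addr0.
have [||c] := @MVT R phi (fun s => g (s *: v + (h *: w + x)) - g (s *: v + x)) 0 h h0.
- by move=> s; rewrite in_itv/= => /andP[s0 sh]; apply: dphi; rewrite !ltW.
- apply: derivable_within_continuous => s; rewrite in_itv/= => sh.
  by have [] := dphi s sh.
rewrite in_itv/= => /andP[c0 ch].
have ch' : 0 <= c <= h by rewrite !ltW.
rewrite /phi !scale0r !add0r subr0 => E1.
have -> : f (h *: v + (h *: w + x)) - f (h *: v + x) - f (h *: w + x) + f x
    = (g (c *: v + (h *: w + x)) - g (c *: v + x)) * h.
  by rewrite -E1; ring.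
have [s1 s2] := small c h ch' h0h; have [s3 s4] := small c 0 ch' z0h.
have r1 := exp _ s2; have r2 := exp _ s4.
rewrite scale0r addr0 in s3 s4 r2.
have Lc : L (c *: v) = c * L v by exact: linearZ.
have Lch : L (c *: v + h *: w) = c * L v + h * L w.
  by rewrite -Lc; have <- : L (h *: w) = h * L w by [exact: linearZ]; exact: linearD.
rewrite Lch -addrA in r1; rewrite Lc in r2.
have -> : (g (c *: v + (h *: w + x)) - g (c *: v + x)) * h - h ^+ 2 * L w
  = h * ((g (c *: v + (h *: w + x)) - (g x + (c * L v + h * L w)))
         - (g (c *: v + x) - (g x + c * L v))) by ring.
rewrite normrM (gtr0_norm h0) [eps * _]mulrC expr2 -mulrA ler_pM2l//.
rewrite (le_trans (ler_normB _ _))// (le_trans (lerD r1 r2))// -mulrDr.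
rewrite (@le_trans _ _ (eps / (2 * M) * (h * M + h * M)))//.
  by rewrite ler_pM2l// lerD.
rewrite le_eqVlt; apply/orP; left; apply/eqP; field.
by rewrite gt_eqF.
Qed.

(** The second difference is symmetric in [v] and [w], so both mixed derivatives are its limit after
    division by [h ^+ 2]. *)
Lemma derive_comm f v w x :
  (\forall z \near x, derivable f z v) -> (\forall z \near x, derivable f z w) ->
  differentiable ('D_v f) x -> differentiable ('D_w f) x ->
  'D_w ('D_v f) x = 'D_v ('D_w f) x.
Proof.
move=> fv fw dv dw; apply/eqP; rewrite -subr_eq0 -normr_le0; apply/ler_addgt0Pl.
move=> e e0; rewrite addr0.
have e20 : 0 < e / 2 by rewrite divr_gt0.
have [d1 d10 h1] := second_difference w fv dv e20.
have [d2 d20 h2] := second_difference v fw dw e20.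
set d := Num.min d1 d2; have d0 : 0 < d by rewrite lt_min d10 d20.
have hd1 : 0 < d / 2 < d1.
  rewrite divr_gt0//= ltr_pdivrMr// (@le_lt_trans _ _ d1) ?ge_min ?lexx//.
  by rewrite ltr_pMr// ltrDl.
have hd2 : 0 < d / 2 < d2.
  rewrite divr_gt0//= ltr_pdivrMr// (@le_lt_trans _ _ d2) ?ge_min ?lexx ?orbT//.
  by rewrite ltr_pMr// ltrDl.
have := h1 _ hd1; have := h2 _ hd2; move: (d / 2) hd1 => h /andP[h0 _].
rewrite (addrCA (h *: w)) => {}h2 {}h1.
have hh : 0 < h ^+ 2 by rewrite exprn_gt0.
rewrite -(ler_pM2l hh) -{1}(gtr0_norm hh) -normrM.
have sum2 (A B1 B2 a1 a2 z : R) :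
    `|z - B1 - B2 + A - h ^+ 2 * a1| <= e / 2 * h ^+ 2 ->
    `|z - B2 - B1 + A - h ^+ 2 * a2| <= e / 2 * h ^+ 2 ->
    `|h ^+ 2 * (a2 - a1)| <= h ^+ 2 * e.
  move=> l1 l2; have -> : h ^+ 2 * (a2 - a1) = (z - B1 - B2 + A - h ^+ 2 * a1)
    - (z - B2 - B1 + A - h ^+ 2 * a2) by ring.
  rewrite (le_trans (ler_normB _ _))// (le_trans (lerD l1 l2))//.
  by rewrite -mulrDl -splitr mulrC.
exact: sum2 h2 h1.
Qed.

End Calculus.

Section Smooth.
Context {R : realType} (V : set 'rV[R]_4).
Hypothesis openV : open V.
Implicit Types (f g : 'rV[R]_4 -> R) (y : 'rV[R]_4).

Lemma open_near_eq (T : Type) (f g : 'rV[R]_4 -> T) y :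
  (forall z, V z -> f z = g z) -> V y -> \forall z \near y, f z = g z.
Proof. by move=> fg Vy; exact: filterS fg (open_nbhs_nbhs (conj openV Vy)). Qed.

Lemma eq_partial f g i y :
  (forall z, V z -> f z = g z) -> V y -> partial i f y = partial i g y.
Proof. by move=> fg Vy; apply: near_eq_derive; exact: open_near_eq. Qed.

Lemma eq_smooth_on f g : (forall z, V z -> f z = g z) -> smooth_on V f -> smooth_on V g.
Proof.
move=> fg sf s y Vy; apply: near_eq_differentiable (sf s y Vy).
apply: open_near_eq Vy; elim: s => [|i s IH] z Vz /=; [exact: fg | exact: eq_partial IH Vz].
Qed.

Lemma smooth_differentiable f y : smooth_on V f -> V y ->
  differentiable (f : 'rV[R]_4 -> R^o) y.
Proof. by move=> sf; exact: (sf [::]). Qed.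

Lemma smooth_partial f i : smooth_on V f -> smooth_on V (partial i f).
Proof.
move=> sf s y Vy; have := sf (rcons s i) y Vy.
by rewrite foldr_rcons.
Qed.

(* Coinduction: a class of differentiable functions stable under partial
   derivatives, up to equality on [V], consists of smooth functions. *)
Lemma smooth_coind (P : ('rV[R]_4 -> R) -> Prop) :
  (forall f y, P f -> V y -> differentiable (f : 'rV[R]_4 -> R^o) y) ->
  (forall f i, P f -> exists2 g, P g & forall y, V y -> partial i f y = g y) ->
  forall f, P f -> smooth_on V f.
Proof.
move=> Pd Pp f Pf s y Vy.
have [g Pg fg] : exists2 g, P g & forall y, V y -> foldr partial f s y = g y.
  elim: s => [|i s [g Pg fg]]; first by exists f.
  have [h Ph gh] := Pp _ i Pg; exists h => // z Vz.
  by rewrite -gh //=; exact: eq_partial fg Vz.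
apply: near_eq_differentiable (Pd _ _ Pg Vy).
by apply: open_near_eq Vy => z Vz; rewrite fg.
Qed.

(** The operations must be closed off together: the derivative of a product is a sum of products,
    and that of an inverse is a product containing inverses. *)
Inductive smooth_class : ('rV[R]_4 -> R) -> Prop :=
| class_smooth f : smooth_on V f -> smooth_class f
| class_cst c : smooth_class (fun=> c)
| class_add f g : smooth_class f -> smooth_class g ->
    smooth_class (fun y => f y + g y)
| class_mul f g : smooth_class f -> smooth_class g ->
    smooth_class (fun y => f y * g y)
| class_inv f : smooth_class f -> (forall y, V y -> f y != 0) ->
    smooth_class (fun y => (f y)^-1).

Lemma smooth_class_differentiable f y : smooth_class f -> V y ->
  differentiable (f : 'rV[R]_4 -> R^o) y.
Proof.
move=> cf Vy; elim: cf => {f}.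
- by move=> f /smooth_differentiable; exact.
- by move=> c; exact: differentiable_cst.
- by move=> f g _ df _ dg; exact: differentiableD.
- by move=> f g _ df _ dg; exact: differentiableM.
- by move=> f _ df f0; apply: differentiableV => //; exact: f0.
Qed.

Lemma partial_derivable f i y : differentiable (f : 'rV[R]_4 -> R^o) y ->
  derivable (f : 'rV[R]_4 -> R^o) y (delta_mx 0 i).
Proof. exact: diff_derivable. Qed.

Lemma partialD f g i y : differentiable (f : 'rV[R]_4 -> R^o) y ->
  differentiable (g : 'rV[R]_4 -> R^o) y ->
  partial i (fun y => f y + g y) y = partial i f y + partial i g y.
Proof. by move=> df dg; apply: deriveD; exact: partial_derivable. Qed.

Lemma partialM f g i y : differentiable (f : 'rV[R]_4 -> R^o) y ->
  differentiable (g : 'rV[R]_4 -> R^o) y ->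
  partial i (fun y => f y * g y) y = partial i f y * g y + f y * partial i g y.
Proof.
move=> df dg; rewrite addrC mulrC [X in _ + X]mulrC [X in X + _]mulrC.
exact: deriveM (@partial_derivable f i y df) (@partial_derivable g i y dg).
Qed.

(** The derivative is written with constants and products only, so that it belongs to
    [smooth_class], which has no constructor for opposites or powers. *)
Lemma partialV f i y : differentiable (f : 'rV[R]_4 -> R^o) y -> f y != 0 ->
  partial i (fun y => (f y)^-1) y = -1 * ((f y)^-1 * (f y)^-1) * partial i f y.
Proof.
move=> df f0; rewrite [LHS](deriveV f0 (@partial_derivable f i y df)).
by rewrite expr2 invfM mulN1r.
Qed.

Lemma partial_cst (c : R) i y : partial i (fun=> c) y = 0.
Proof. exact: derive_cst. Qed.

Lemma smooth_class_smooth f : smooth_class f -> smooth_on V f.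
Proof.
apply: smooth_coind => [{}f y|]; first exact: smooth_class_differentiable.
move=> {}f i; elim=> {f}.
- by move=> f sf; exists (partial i f) => //; exact/class_smooth/smooth_partial.
- by move=> c; exists (fun=> 0) => [|y _]; [exact: class_cst | exact: partial_cst].
- move=> f g cf [f' cf' ff'] cg [g' cg' gg'].
  exists (fun y => f' y + g' y) => [|y Vy]; first exact: class_add.
  by rewrite partialD ?ff' ?gg'//; exact: smooth_class_differentiable.
- move=> f g cf [f' cf' ff'] cg [g' cg' gg'].
  exists (fun y => f' y * g y + f y * g' y) => [|y Vy].
    by apply: class_add; exact: class_mul.
  by rewrite partialM ?ff' ?gg'//; exact: smooth_class_differentiable.
- move=> f cf [f' cf' ff'] f0.
  exists (fun y => -1 * ((f y)^-1 * (f y)^-1) * f' y) => [|y Vy].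
    apply: class_mul => //; apply: class_mul; first exact: class_cst.
    by apply: class_mul; exact: class_inv.
  by rewrite partialV ?ff' ?f0//; exact: smooth_class_differentiable.
Qed.

Lemma smooth_onD f g : smooth_on V f -> smooth_on V g ->
  smooth_on V (fun y => f y + g y).
Proof. by move=> sf sg; apply/smooth_class_smooth/class_add; exact: class_smooth. Qed.

Lemma smooth_onM f g : smooth_on V f -> smooth_on V g ->
  smooth_on V (fun y => f y * g y).
Proof. by move=> sf sg; apply/smooth_class_smooth/class_mul; exact: class_smooth. Qed.

Lemma smooth_onV f : smooth_on V f -> (forall y, V y -> f y != 0) ->
  smooth_on V (fun y => (f y)^-1).
Proof. by move=> sf f0; apply/smooth_class_smooth/class_inv => //; exact: class_smooth. Qed.

Lemma smooth_on_cst c : smooth_on V (fun=> c).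
Proof. exact/smooth_class_smooth/class_cst. Qed.

Lemma smooth_onN f : smooth_on V f -> smooth_on V (fun y => - f y).
Proof.
move=> sf; apply: (@eq_smooth_on (fun y => -1 * f y)) => [y _|]; first exact: mulN1r.
exact: smooth_onM (smooth_on_cst _) sf.
Qed.

Lemma partial_comm f i j y : smooth_on V f -> V y ->
  partial i (partial j f) y = partial j (partial i f) y.
Proof.
move=> sf Vy.
have near_der l : \forall z \near y, derivable (f : 'rV[R]_4 -> R^o) z (delta_mx 0 l).
  apply: filterS (open_nbhs_nbhs (conj openV Vy)) => z Vz.
  exact: partial_derivable (smooth_differentiable sf Vz).
by apply: derive_comm => //; exact: smooth_differentiable (smooth_partial _ sf) Vy.
Qed.

End Smooth.

Section ComplexSmooth.
Context {R : realType} (V : set 'rV[R]_4).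
Hypothesis openV : open V.
Implicit Types (f g : 'rV[R]_4 -> R[i]) (y : 'rV[R]_4) (c : R[i]).

Lemma ReD (a b : R[i]) : complex.Re (a + b) = complex.Re a + complex.Re b.
Proof. by case: a b => [? ?] [? ?]. Qed.

Lemma ImD (a b : R[i]) : complex.Im (a + b) = complex.Im a + complex.Im b.
Proof. by case: a b => [? ?] [? ?]. Qed.

Lemma ReM (a b : R[i]) : complex.Re (a * b)
  = complex.Re a * complex.Re b + - (complex.Im a * complex.Im b).
Proof. by case: a b => [? ?] [? ?]. Qed.

Lemma ImM (a b : R[i]) : complex.Im (a * b)
  = complex.Re a * complex.Im b + complex.Im a * complex.Re b.
Proof. by case: a b => [? ?] [? ?]. Qed.

Lemma complex_eqP (a b : R[i]) :
  complex.Re a = complex.Re b -> complex.Im a = complex.Im b -> a = b.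
Proof. by case: a b => [? ?] [? ?] /= -> ->. Qed.

Lemma eq_csmooth_on f g : (forall z, V z -> f z = g z) -> csmooth_on V f -> csmooth_on V g.
Proof.
by move=> fg [sr si]; split; [apply: eq_smooth_on sr | apply: eq_smooth_on si] => // z Vz;
  rewrite fg.
Qed.

Lemma csmooth_cst c : csmooth_on V (fun=> c).
Proof. by split; exact: smooth_on_cst. Qed.

Lemma csmoothD f g : csmooth_on V f -> csmooth_on V g ->
  csmooth_on V (fun y => f y + g y).
Proof.
move=> [fr fi] [gr gi]; split.
  by apply: eq_smooth_on (smooth_onD openV fr gr) => // y _; rewrite ReD.
by apply: eq_smooth_on (smooth_onD openV fi gi) => // y _; rewrite ImD.
Qed.

Lemma csmoothM f g : csmooth_on V f -> csmooth_on V g ->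
  csmooth_on V (fun y => f y * g y).
Proof.
move=> [fr fi] [gr gi]; split.
  apply: eq_smooth_on (smooth_onD openV (smooth_onM openV fr gr)
    (smooth_onN openV (smooth_onM openV fi gi))) => // y _; by rewrite ReM.
apply: eq_smooth_on (smooth_onD openV (smooth_onM openV fr gi)
  (smooth_onM openV fi gr)) => // y _; by rewrite ImM.
Qed.

Lemma csmoothN f : csmooth_on V f -> csmooth_on V (fun y => - f y).
Proof.
move=> sf; apply: (@eq_csmooth_on (fun y => -1 * f y)) => [y _|]; first exact: mulN1r.
exact: csmoothM (csmooth_cst _) sf.
Qed.

Lemma csmoothV f : csmooth_on V f -> (forall y, V y -> f y != 0) ->
  csmooth_on V (fun y => (f y)^-1).
Proof.
move=> [fr fi] f0.
(* The squared modulus of [f]: the inverse is the conjugate of [f] divided by [q]. *)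
pose q y : R := complex.Re (f y) * complex.Re (f y) + complex.Im (f y) * complex.Im (f y).
have q0 y : V y -> q y != 0.
  move=> Vy; rewrite /q -!expr2 paddr_eq0 ?sqr_ge0// !sqrf_eq0.
  by have := f0 y Vy; rewrite eq_complex.
have sq : smooth_on V (fun y => (q y)^-1).
  by apply: smooth_onV => //; apply: smooth_onD => //; exact: smooth_onM.
have inv y : V y -> (f y)^-1
    = (complex.Re (f y) * (q y)^-1 +i* - (complex.Im (f y) * (q y)^-1))%C.
  move=> Vy; have := q0 y Vy; have := f0 y Vy; rewrite /q; case: (f y) => a b /= ab qy.
  by congr (_ +i* _)%C; rewrite !expr2.
split.
  by apply: (eq_smooth_on openV _ (smooth_onM openV fr sq)) => y Vy; rewrite inv.
by apply: (eq_smooth_on openV _ (smooth_onN openV (smooth_onM openV fi sq))) => y Vy; rewrite inv.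
Qed.

Lemma csmooth_sum (I : Type) (r : seq I) (F : I -> 'rV[R]_4 -> R[i]) :
  (forall i, csmooth_on V (F i)) -> csmooth_on V (fun y => \sum_(i <- r) F i y).
Proof.
move=> sF; elim: r => [|i r IH].
  by apply: (@eq_csmooth_on (fun=> 0)) (csmooth_cst _) => y _; rewrite big_nil.
apply: (@eq_csmooth_on (fun y => F i y + \sum_(i <- r) F i y)) => [y _|].
  by rewrite big_cons.
exact: csmoothD.
Qed.

Lemma csmooth_prod (I : Type) (r : seq I) (F : I -> 'rV[R]_4 -> R[i]) :
  (forall i, csmooth_on V (F i)) -> csmooth_on V (fun y => \prod_(i <- r) F i y).
Proof.
move=> sF; elim: r => [|i r IH].
  by apply: (@eq_csmooth_on (fun=> 1)) (csmooth_cst _) => y _; rewrite big_nil.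
apply: (@eq_csmooth_on (fun y => F i y * \prod_(i <- r) F i y)) => [y _|].
  by rewrite big_cons.
exact: csmoothM.
Qed.

Lemma csmooth_det n (X : 'rV[R]_4 -> 'M[R[i]]_n) :
  cmxsmooth_on V X -> csmooth_on V (fun y => \det (X y)).
Proof.
move=> sX; apply: csmooth_sum => s; apply: csmoothM; first exact: csmooth_cst.
by apply: csmooth_prod => i; exact: sX.
Qed.

Lemma cmxsmooth_inv (X : 'rV[R]_4 -> 'M[R[i]]_4) :
  cmxsmooth_on V X -> (forall y, V y -> X y \in unitmx) ->
  cmxsmooth_on V (fun y => invmx (X y)).
Proof.
move=> sX uX i j.
apply: (@eq_csmooth_on (fun y => (\det (X y))^-1 * cofactor (X y) j i)) => [y Vy|].
  by rewrite /invmx uX// !mxE.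
apply: csmoothM; first apply: csmoothV; first exact: csmooth_det.
  by move=> y Vy; have := uX y Vy; rewrite unitmxE unitfE.
apply: csmoothM; first exact: csmooth_cst.
apply: csmooth_det => a b; apply: eq_csmooth_on (sX (lift j a) (lift i b)).
by move=> y _; rewrite !mxE.
Qed.

Lemma eq_cpartial f g i y : (forall z, V z -> f z = g z) -> V y ->
  cpartial i f y = cpartial i g y.
Proof.
by move=> fg Vy; congr (_ +i* _)%C; apply: (eq_partial openV) => // z Vz; rewrite fg.
Qed.

Lemma csmooth_partial f i : csmooth_on V f -> csmooth_on V (cpartial i f).
Proof. by move=> [sr si]; split; exact: smooth_partial. Qed.

Lemma cpartialD f g i y : csmooth_on V f -> csmooth_on V g -> V y ->
  cpartial i (fun y => f y + g y) y = cpartial i f y + cpartial i g y.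
Proof.
move=> [fr fi] [gr gi] Vy; apply: complex_eqP; rewrite ?ReD ?ImD /=.
  rewrite -partialD; try exact: smooth_differentiable Vy.
  by congr (partial i _ y); apply/funext => z; rewrite ReD.
rewrite -partialD; try exact: smooth_differentiable Vy.
by congr (partial i _ y); apply/funext => z; rewrite ImD.
Qed.

Lemma cpartialM f g i y : csmooth_on V f -> csmooth_on V g -> V y ->
  cpartial i (fun y => f y * g y) y = cpartial i f y * g y + f y * cpartial i g y.
Proof.
move=> [fr fi] [gr gi] Vy.
have D (h : 'rV[R]_4 -> R) : smooth_on V h -> differentiable (h : 'rV[R]_4 -> R^o) y.
  by move=> sh; exact: smooth_differentiable Vy.
have sM h l := @smooth_onM R V openV h l.
have s1 : smooth_on V (fun=> -1 : R) by exact: smooth_on_cst.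
apply: complex_eqP; rewrite ?ReD ?ImD ?ReM ?ImM /=.
  rewrite [LHS](_ : _ = partial i (fun z => complex.Re (f z) * complex.Re (g z)
      + -1 * (complex.Im (f z) * complex.Im (g z))) y); last first.
    by congr (partial i _ y); apply/funext => z; rewrite ReM mulN1r.
  rewrite (partialD i (D _ (sM _ _ fr gr)) (D _ (sM _ _ s1 (sM _ _ fi gi)))).
  rewrite (partialM i (D _ fr) (D _ gr)) (partialM i (D _ s1) (D _ (sM _ _ fi gi))).
  by rewrite (partialM i (D _ fi) (D _ gi)) partial_cst; ring.
rewrite [LHS](_ : _ = partial i (fun z => complex.Re (f z) * complex.Im (g z)
    + complex.Im (f z) * complex.Re (g z)) y); last first.
  by congr (partial i _ y); apply/funext => z; rewrite ImM.
rewrite (partialD i (D _ (sM _ _ fr gi)) (D _ (sM _ _ fi gr))).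
by rewrite (partialM i (D _ fr) (D _ gi)) (partialM i (D _ fi) (D _ gr)); ring.
Qed.

Lemma cpartial_comm f i j y : csmooth_on V f -> V y ->
  cpartial i (cpartial j f) y = cpartial j (cpartial i f) y.
Proof.
move=> [sr si] Vy; rewrite {1 3}/cpartial.
have -> : partial i (fun z => complex.Re (cpartial j f z)) y
    = partial j (partial i (fun z => complex.Re (f z))) y.
  exact: (partial_comm openV i j sr Vy).
have -> // : partial i (fun z => complex.Im (cpartial j f z)) y
    = partial j (partial i (fun z => complex.Im (f z))) y.
exact: (partial_comm openV i j si Vy).
Qed.

Lemma csmooth_neq0_near f y : csmooth_on V f -> V y -> f y != 0 ->
  \forall z \near y, f z != 0.
Proof.
have neq0 (r : R^o) : r != 0 -> nbhs r [set z | z != 0].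
  by move=> r0; apply: open_nbhs_nbhs; split; [exact: open_neq | exact: r0].
move=> [sr si] Vy; rewrite eq_complex negb_and => /orP[] /neq0 h0.
  have /differentiable_continuous fc := smooth_differentiable sr Vy.
  by apply: (@filterS _ (nbhs y) _ _ _ _ (fc _ h0)) => z /= z0; rewrite eq_complex negb_and z0.
have /differentiable_continuous fc := smooth_differentiable si Vy.
by apply: (@filterS _ (nbhs y) _ _ _ _ (fc _ h0)) => z /= z0; rewrite eq_complex negb_and z0 orbT.
Qed.

End ComplexSmooth.

(** * The commutative ring of functions smooth on an open set, with its partial derivatives *)

Section SmoothRing.
Context {R : realType}.

(* Smoothness is only required on [V]; outside, the functions are arbitrary. *)
Record csmooth_fun (V : {V : set 'rV[R]_4 | open V}) := CSmooth {
  csmooth_val :> 'rV[R]_4 -> R[i]; csmooth_funP : csmooth_on (sval V) csmooth_val }.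

Variable V : {V : set 'rV[R]_4 | open V}.
Implicit Types f g h : csmooth_fun V.

HB.instance Definition _ := gen_eqMixin (csmooth_fun V).
HB.instance Definition _ := gen_choiceMixin (csmooth_fun V).

Lemma csmooth_fun_eq f g : (forall y, f y = g y) -> f = g.
Proof.
case: f g => [f sf] [g sg] /= /funext fg; rewrite fg in sf *.
by congr CSmooth; exact: Prop_irrelevance.
Qed.

Definition fun_cst c : csmooth_fun V := CSmooth (csmooth_cst (svalP V) c).
Definition fun_add f g : csmooth_fun V :=
  CSmooth (csmoothD (svalP V) (csmooth_funP f) (csmooth_funP g)).
Definition fun_opp f : csmooth_fun V := CSmooth (csmoothN (svalP V) (csmooth_funP f)).
Definition fun_mul f g : csmooth_fun V :=
  CSmooth (csmoothM (svalP V) (csmooth_funP f) (csmooth_funP g)).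

Lemma fun_addA : associative fun_add.
Proof. by move=> f g h; apply: csmooth_fun_eq => y; exact: addrA. Qed.
Lemma fun_addC : commutative fun_add.
Proof. by move=> f g; apply: csmooth_fun_eq => y; exact: addrC. Qed.
Lemma fun_add0 : left_id (fun_cst 0) fun_add.
Proof. by move=> f; apply: csmooth_fun_eq => y; exact: add0r. Qed.
Lemma fun_addN : left_inverse (fun_cst 0) fun_opp fun_add.
Proof. by move=> f; apply: csmooth_fun_eq => y; exact: addNr. Qed.
Lemma fun_mulA : associative fun_mul.
Proof. by move=> f g h; apply: csmooth_fun_eq => y; exact: mulrA. Qed.
Lemma fun_mulC : commutative fun_mul.
Proof. by move=> f g; apply: csmooth_fun_eq => y; exact: mulrC. Qed.
Lemma fun_mul1 : left_id (fun_cst 1) fun_mul.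
Proof. by move=> f; apply: csmooth_fun_eq => y; exact: mul1r. Qed.
Lemma fun_mulD : left_distributive fun_mul fun_add.
Proof. by move=> f g h; apply: csmooth_fun_eq => y; exact: mulrDl. Qed.

HB.instance Definition _ := GRing.isZmodule.Build (csmooth_fun V)
  fun_addA fun_addC fun_add0 fun_addN.
HB.instance Definition _ := GRing.Zmodule_isComPzRing.Build (csmooth_fun V)
  fun_mulA fun_mulC fun_mul1 fun_mulD.

(** The value 0 outside [V] makes additivity, the Leibniz rule and commutation hold as equalities of
    functions on the whole space, hence in the ring. *)
Definition fun_partial_def (i : 'I_4) f (y : 'rV[R]_4) : R[i] :=
  if pselect (sval V y) then cpartial i f y else 0.

Lemma fun_partial_smooth i f : csmooth_on (sval V) (fun_partial_def i f).
Proof.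
apply: (eq_csmooth_on (svalP V) _ (csmooth_partial i (csmooth_funP f))) => y Vy.
by rewrite /fun_partial_def; case: pselect.
Qed.

Definition fun_partial i f : csmooth_fun V := CSmooth (fun_partial_smooth i f).

Lemma fun_partialE i f y : sval V y -> fun_partial i f y = cpartial i f y.
Proof. by move=> Vy; rewrite /= /fun_partial_def; case: pselect. Qed.

Lemma fun_partial_out i f y : ~ sval V y -> fun_partial i f y = 0.
Proof. by move=> Vy; rewrite /= /fun_partial_def; case: pselect. Qed.

Lemma csmooth_valD f g : csmooth_val (f + g) = fun y => f y + g y.
Proof. by []. Qed.

Lemma csmooth_valM f g : csmooth_val (f * g) = fun y => f y * g y.
Proof. by []. Qed.

Lemma fun_partialD i f g : fun_partial i (f + g) = fun_partial i f + fun_partial i g.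
Proof.
apply: csmooth_fun_eq => y; rewrite [RHS](congr1 (@^~ y) (csmooth_valD _ _)).
have [Vy|nVy] := pselect (sval V y); last by rewrite !fun_partial_out// addr0.
rewrite !fun_partialE// csmooth_valD.
exact: cpartialD (csmooth_funP f) (csmooth_funP g) Vy.
Qed.

Lemma fun_partialM i f g :
  fun_partial i (f * g) = fun_partial i f * g + f * fun_partial i g.
Proof.
apply: csmooth_fun_eq => y.
rewrite csmooth_valD !csmooth_valM.
have [Vy|nVy] := pselect (sval V y); last first.
  by rewrite !fun_partial_out// mul0r mulr0 addr0.
rewrite !fun_partialE// csmooth_valM.
exact: (cpartialM (svalP V) i (csmooth_funP f) (csmooth_funP g) Vy).
Qed.

Lemma fun_partialC i j f : fun_partial i (fun_partial j f) = fun_partial j (fun_partial i f).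
Proof.
apply: csmooth_fun_eq => y.
have [Vy|nVy] := pselect (sval V y); last by rewrite !fun_partial_out.
rewrite !(fun_partialE _ _ Vy) (eq_cpartial (svalP V) i (fun_partialE j f) Vy).
rewrite (eq_cpartial (svalP V) j (fun_partialE i f) Vy).
exact: (cpartial_comm (svalP V) i j (csmooth_funP f) Vy).
Qed.

(** As a ring morphism, evaluation turns the identities of the abstract part into identities at the
    point [y]. *)
Definition fun_eval (y : 'rV[R]_4) f : R[i] := f y.

Lemma fun_eval_is_zmod y : zmod_morphism (fun_eval y).
Proof. by []. Qed.

Lemma fun_eval_is_monoid y : monoid_morphism (fun_eval y).
Proof. by []. Qed.

HB.instance Definition _ y := GRing.isZmodMorphism.Build _ _ (fun_eval y) (fun_eval_is_zmod y).
HB.instance Definition _ y := GRing.isMonoidMorphism.Build _ _ (fun_eval y) (fun_eval_is_monoid y).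

End SmoothRing.

Arguments fun_eval : simpl never.

(** * Hodge duality in a null frame *)

Section FourDeterminant.
Variable K : comPzRingType.
Implicit Types (X : 'M[K]_4) (F : 'I_4 -> K).

Definition i0 : 'I_4 := Ordinal (isT : (0 < 4)%N).
Definition i1 : 'I_4 := Ordinal (isT : (1 < 4)%N).
Definition i2 : 'I_4 := Ordinal (isT : (2 < 4)%N).
Definition i3 : 'I_4 := Ordinal (isT : (3 < 4)%N).

Lemma ord4P (P : 'I_4 -> Prop) : P i0 -> P i1 -> P i2 -> P i3 -> forall i, P i.
Proof.
move=> P0 P1 P2 P3 [[|[|[|[|//]]]] lt].
- by rewrite (_ : Ordinal lt = i0)//; apply: val_inj.
- by rewrite (_ : Ordinal lt = i1)//; apply: val_inj.
- by rewrite (_ : Ordinal lt = i2)//; apply: val_inj.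
- by rewrite (_ : Ordinal lt = i3)//; apply: val_inj.
Qed.

Lemma sum4 F : \sum_i F i = F i0 + F i1 + F i2 + F i3.
Proof.
rewrite !big_ord_recl big_ord0 addr0 !addrA.
by congr (F _ + F _ + F _ + F _); apply: val_inj.
Qed.

Lemma det4 X : \det X =
    X i0 i0 * X i1 i1 * X i2 i2 * X i3 i3 - X i0 i0 * X i1 i1 * X i2 i3 * X i3 i2
  - X i0 i0 * X i1 i2 * X i2 i1 * X i3 i3 + X i0 i0 * X i1 i2 * X i2 i3 * X i3 i1
  + X i0 i0 * X i1 i3 * X i2 i1 * X i3 i2 - X i0 i0 * X i1 i3 * X i2 i2 * X i3 i1
  - X i0 i1 * X i1 i0 * X i2 i2 * X i3 i3 + X i0 i1 * X i1 i0 * X i2 i3 * X i3 i2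
  + X i0 i1 * X i1 i2 * X i2 i0 * X i3 i3 - X i0 i1 * X i1 i2 * X i2 i3 * X i3 i0
  - X i0 i1 * X i1 i3 * X i2 i0 * X i3 i2 + X i0 i1 * X i1 i3 * X i2 i2 * X i3 i0
  + X i0 i2 * X i1 i0 * X i2 i1 * X i3 i3 - X i0 i2 * X i1 i0 * X i2 i3 * X i3 i1
  - X i0 i2 * X i1 i1 * X i2 i0 * X i3 i3 + X i0 i2 * X i1 i1 * X i2 i3 * X i3 i0
  + X i0 i2 * X i1 i3 * X i2 i0 * X i3 i1 - X i0 i2 * X i1 i3 * X i2 i1 * X i3 i0
  - X i0 i3 * X i1 i0 * X i2 i1 * X i3 i2 + X i0 i3 * X i1 i0 * X i2 i2 * X i3 i1
  + X i0 i3 * X i1 i1 * X i2 i0 * X i3 i2 - X i0 i3 * X i1 i1 * X i2 i2 * X i3 i0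
  - X i0 i3 * X i1 i2 * X i2 i0 * X i3 i1 + X i0 i3 * X i1 i2 * X i2 i1 * X i3 i0.
Proof.
(* Indexing by naturals lets the iterated [lift]s of the cofactors compute to numerals, so that
   [ring] recognizes equal entries. *)
pose Y (i j : nat) : K := X (inord i) (inord j).
have XY (i j : 'I_4) : X i j = Y i j by rewrite /Y !inord_val.
rewrite !(expand_det_row _ ord0) /cofactor !big_ord_recl !big_ord0 /=.
rewrite !(expand_det_row _ ord0) /cofactor !big_ord_recl !big_ord0 /=.
rewrite !(expand_det_row _ ord0) /cofactor !big_ord_recl !big_ord0 /=.
rewrite !det_mx11 !mxE !XY /= /bump /=.
by ring.
Qed.

End FourDeterminant.

Section LeviCivita.
Variable R : realType.
Local Notation K := R[i].
Implicit Types (x y z w : 'I_4 -> K) (X : 'M[K]_4).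

Definition mx4 x y z w : 'M[K]_4 :=
  \matrix_(r, s) (tnth [tuple x; y; z; w] r s).

Definition unit4 (a : 'I_4) : 'I_4 -> K := fun s => (a == s)%:R.

Lemma levi_civitaE a b c d :
  levi_civita a b c d = \det (mx4 (unit4 a) (unit4 b) (unit4 c) (unit4 d)).
Proof.
congr determinant; apply/matrixP=> i j; rewrite !mxE; move: i.
by apply: ord4P.
Qed.

(** Linearity of the determinant in row [r], whose entries are the coefficients of the unit rows;
    both sides are expanded along that row. *)
Lemma sum_det_unit_row (r : 'I_4) (X : 'I_4 -> 'M[K]_4) (Y : 'M[K]_4) :
  (forall a s, X a r s = unit4 a s) ->
  (forall a i s, i != r -> X a i s = Y i s) ->
  \sum_a \det (X a) * Y r a = \det Y.
Proof.
move=> Xr Xn; rewrite [RHS](expand_det_row _ r).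
under eq_bigr do rewrite (expand_det_row _ r) mulr_suml.
rewrite exchange_big; apply: eq_bigr => j _ /=.
rewrite (bigD1 j)//= big1 ?addr0 => [|a /negPf aj]; last by rewrite Xr /unit4 aj !mul0r.
rewrite Xr /unit4 eqxx mul1r mulrC; congr (_ * (_ * \det _)).
by apply/matrixP => i s; rewrite !mxE Xn// eq_sym neq_lift.
Qed.

Lemma det_mx4_row0 x y z w : \sum_a \det (mx4 (unit4 a) y z w) * x a = \det (mx4 x y z w).
Proof.
rewrite -(@sum_det_unit_row i0 (fun a => mx4 (unit4 a) y z w)) => [|a s|a].
- by apply: eq_bigr => a _; rewrite !mxE.
- by rewrite mxE.
- by apply: ord4P => s // _; rewrite !mxE.
Qed.

Lemma det_mx4_row1 x y z w : \sum_a \det (mx4 x (unit4 a) z w) * y a = \det (mx4 x y z w).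
Proof.
rewrite -(@sum_det_unit_row i1 (fun a => mx4 x (unit4 a) z w)) => [|a s|a].
- by apply: eq_bigr => a _; rewrite !mxE.
- by rewrite mxE.
- by apply: ord4P => s // _; rewrite !mxE.
Qed.

Lemma det_mx4_row2 x y z w : \sum_a \det (mx4 x y (unit4 a) w) * z a = \det (mx4 x y z w).
Proof.
rewrite -(@sum_det_unit_row i2 (fun a => mx4 x y (unit4 a) w)) => [|a s|a].
- by apply: eq_bigr => a _; rewrite !mxE.
- by rewrite mxE.
- by apply: ord4P => s // _; rewrite !mxE.
Qed.

Lemma det_mx4_row3 x y z w : \sum_a \det (mx4 x y z (unit4 a)) * w a = \det (mx4 x y z w).
Proof.
rewrite -(@sum_det_unit_row i3 (fun a => mx4 x y z (unit4 a))) => [|a s|a].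
- by apply: eq_bigr => a _; rewrite !mxE.
- by rewrite mxE.
- by apply: ord4P => s // _; rewrite !mxE.
Qed.

Lemma levi_civita_det x y z w :
  \sum_a \sum_b \sum_c \sum_d levi_civita a b c d * w d * z c * y b * x a
  = \det (mx4 x y z w).
Proof.
rewrite -det_mx4_row0; apply: eq_bigr => a _.
rewrite -det_mx4_row1 mulr_suml; apply: eq_bigr => b _.
rewrite -det_mx4_row2 !mulr_suml; apply: eq_bigr => c _.
rewrite -det_mx4_row3 !mulr_suml; apply: eq_bigr => d _.
by rewrite levi_civitaE.
Qed.

Lemma mx4E x y z w s : [/\ mx4 x y z w i0 s = x s, mx4 x y z w i1 s = y s,
  mx4 x y z w i2 s = z s & mx4 x y z w i3 s = w s].
Proof. by rewrite !mxE. Qed.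

(** Laplace expansion by 2 x 2 minors of the first two rows. It separates [x, y] from [z, w], as the
    contraction of the last two indices with a 2-form requires. *)
Lemma det_mx4_laplace x y z w : \det (mx4 x y z w) =
    (x i0 * y i1 - x i1 * y i0) * (z i2 * w i3 - z i3 * w i2)
  - (x i0 * y i2 - x i2 * y i0) * (z i1 * w i3 - z i3 * w i1)
  + (x i0 * y i3 - x i3 * y i0) * (z i1 * w i2 - z i2 * w i1)
  + (x i1 * y i2 - x i2 * y i1) * (z i0 * w i3 - z i3 * w i0)
  - (x i1 * y i3 - x i3 * y i1) * (z i0 * w i2 - z i2 * w i0)
  + (x i2 * y i3 - x i3 * y i2) * (z i0 * w i1 - z i1 * w i0).
Proof.
rewrite det4; have [-> -> -> ->] := mx4E x y z w i0; have [-> -> -> ->] := mx4E x y z w i1.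
have [-> -> -> ->] := mx4E x y z w i2; have [-> -> -> ->] := mx4E x y z w i3.
by ring.
Qed.

(* [X |-> 1/2 epsilon_(abcd) X_(cd)], the Hodge dual of a frame of determinant one. *)
Definition star4 X : 'M[K]_4 :=
  \matrix_(a, b) (2^-1 * \sum_c \sum_d levi_civita a b c d * X c d).

Lemma star4E X : X^T = - X ->
  [/\ star4 X i0 i1 = X i2 i3, star4 X i0 i2 = - X i1 i3, star4 X i0 i3 = X i1 i2,
      star4 X i1 i2 = X i0 i3 & star4 X i1 i3 = - X i0 i2]
  /\ [/\ star4 X i2 i3 = X i0 i1, (star4 X)^T = - star4 X & forall i, star4 X i i = 0].
Proof.
move=> /matrixP Xa.
have a10 : X i1 i0 = - X i0 i1 by have := Xa i0 i1; rewrite !mxE.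
have a20 : X i2 i0 = - X i0 i2 by have := Xa i0 i2; rewrite !mxE.
have a30 : X i3 i0 = - X i0 i3 by have := Xa i0 i3; rewrite !mxE.
have a21 : X i2 i1 = - X i1 i2 by have := Xa i1 i2; rewrite !mxE.
have a31 : X i3 i1 = - X i1 i3 by have := Xa i1 i3; rewrite !mxE.
have a32 : X i3 i2 = - X i2 i3 by have := Xa i2 i3; rewrite !mxE.
(* By antisymmetry of [X] each unordered pair of indices is counted twice; this 2 cancels the [2^-1]
   of [star4]. *)
have lcE a b : \sum_c \sum_d levi_civita a b c d * X c d =
    2 * ((unit4 a i0 * unit4 b i1 - unit4 a i1 * unit4 b i0) * X i2 i3
       - (unit4 a i0 * unit4 b i2 - unit4 a i2 * unit4 b i0) * X i1 i3
       + (unit4 a i0 * unit4 b i3 - unit4 a i3 * unit4 b i0) * X i1 i2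
       + (unit4 a i1 * unit4 b i2 - unit4 a i2 * unit4 b i1) * X i0 i3
       - (unit4 a i1 * unit4 b i3 - unit4 a i3 * unit4 b i1) * X i0 i2
       + (unit4 a i2 * unit4 b i3 - unit4 a i3 * unit4 b i2) * X i0 i1).
  under eq_bigr do under eq_bigr do rewrite levi_civitaE det_mx4_laplace.
  move: (unit4 a) (unit4 b) => u v.
  rewrite !sum4 /unit4 /= a10 a20 a30 a21 a31 a32.
  by ring.
have sE a b : star4 X a b =
    (unit4 a i0 * unit4 b i1 - unit4 a i1 * unit4 b i0) * X i2 i3
       - (unit4 a i0 * unit4 b i2 - unit4 a i2 * unit4 b i0) * X i1 i3
       + (unit4 a i0 * unit4 b i3 - unit4 a i3 * unit4 b i0) * X i1 i2
       + (unit4 a i1 * unit4 b i2 - unit4 a i2 * unit4 b i1) * X i0 i3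
       - (unit4 a i1 * unit4 b i3 - unit4 a i3 * unit4 b i1) * X i0 i2
       + (unit4 a i2 * unit4 b i3 - unit4 a i3 * unit4 b i2) * X i0 i1.
  by rewrite mxE lcE mulKf// pnatr_eq0.
split; split; rewrite ?sE /unit4 /=; try by ring.
- by apply/matrixP=> i j; rewrite [LHS]mxE [RHS]mxE !sE; ring.
- by move=> i; rewrite sE; ring.
Qed.

End LeviCivita.

(** * Null frames, and the Hodge star in their components *)

Section NullFrame.
Variable R : realType.
Local Notation K := R[i].
Variables (G : 'rV[R]_4 -> 'M[K]_4) (y : 'rV[R]_4).
Hypothesis symG : (G y)^T = G y.
Hypothesis unitG : G y \in unitmx.
Implicit Types (u v w m p n k : 'rV[K]_4) (F X : 'M[K]_4).

Lemma innerC v w : inner G y v w = inner G y w v.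
Proof.
by rewrite /inner -[LHS](mxE trmx_key (fun i j => (v *m G y *m w^T) j i))
  -/(_^T) !trmx_mul trmxK symG mulmxA.
Qed.

Lemma innerDl u v w : inner G y (u + v) w = inner G y u w + inner G y v w.
Proof. by rewrite /inner !mulmxDl mxE. Qed.

Lemma innerZl (a : K) v w : inner G y (a *: v) w = a * inner G y v w.
Proof. by rewrite /inner -!scalemxAl mxE. Qed.

Lemma innerNl v w : inner G y (- v) w = - inner G y v w.
Proof. by rewrite -scaleN1r innerZl mulN1r. Qed.

Lemma innerDr u v w : inner G y w (u + v) = inner G y w u + inner G y w v.
Proof. by rewrite !(innerC w) innerDl. Qed.

Lemma innerZr (a : K) v w : inner G y w (a *: v) = a * inner G y w v.
Proof. by rewrite !(innerC w) innerZl. Qed.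

Lemma innerNr v w : inner G y w (- v) = - inner G y w v.
Proof. by rewrite !(innerC w) innerNl. Qed.

Section Frame.
Variables m p n k : 'rV[K]_4.
Hypothesis null : null_frame G y m p n k.

Definition frame_mx : 'M[K]_4 := mx4 (m 0) (p 0) (n 0) (k 0).

(* The matrix of the metric in a null frame; it exchanges m, p and n, k. *)
Definition null_mx : 'M[K]_4 :=
  \matrix_(i, j) ((i + j == 1)%N || (i + j == 5)%N)%:R.

Local Notation E := frame_mx.
Local Notation H := null_mx.

Lemma frame_row : [/\ row i0 E = m, row i1 E = p, row i2 E = n & row i3 E = k].
Proof. by split; apply/rowP=> j; rewrite !mxE. Qed.

Lemma row_inner F i j : (E *m F *m E^T) i j = (row i E *m F *m (row j E)^T) 0 0.
Proof.
rewrite -row_mul !mxE; apply: eq_bigr => a _; rewrite !mxE; congr (_ * _).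
Qed.

Lemma frame_metric : E *m G y *m E^T = H.
Proof.
have [e0 e1 e2 e3] := frame_row.
have [[mp nk] [mm pp nn kk] [mn mk pn pk]] := null.
apply/matrixP => i j; rewrite row_inner -/(inner G y _ _); move: i j.
have pm := innerC p m; have kn := innerC k n; have nm := innerC n m.
have km := innerC k m; have np := innerC n p; have kp := innerC k p.
rewrite mp in pm; rewrite nk in kn; rewrite mn in nm; rewrite mk in km.
rewrite pn in np; rewrite pk in kp.
by apply: ord4P; apply: ord4P; rewrite ?e0 ?e1 ?e2 ?e3 [RHS]mxE
  ?mm ?mp ?mn ?mk ?pm ?pp ?pn ?pk ?nm ?np ?nn ?nk ?km ?kp ?kn ?kk.
Qed.

Lemma null_mxK : H *m H = 1%:M.
Proof.
by apply/matrixP; apply: ord4P; apply: ord4P; rewrite mxE sum4 !mxE /=; ring.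
Qed.

Lemma frame_mxK : G y *m E^T *m H *m E = 1%:M.
Proof. by apply: mulmx1C; rewrite !mulmxA frame_metric null_mxK. Qed.

Lemma frame_mx_unit : E \in unitmx.
Proof. by have /mulmx1_unit[_ ->] := frame_mxK. Qed.

Lemma invmx_frame : invmx (G y) = E^T *m H *m E.
Proof.
by rewrite -[LHS]mulmx1 -frame_mxK -!mulmxA mulKmx.
Qed.

Lemma null_mx_row j : [/\ (H *m E) i0 j = p 0 j, (H *m E) i1 j = m 0 j,
  (H *m E) i2 j = k 0 j & (H *m E) i3 j = n 0 j].
Proof.
have [E0 E1 E2 E3] := mx4E (m 0) (p 0) (n 0) (k 0) j.
by split; rewrite mxE sum4 E0 E1 E2 E3 !mxE /=; ring.
Qed.

Lemma invmx_frameE a b : invmx (G y) a b =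
  m 0 a * p 0 b + p 0 a * m 0 b + n 0 a * k 0 b + k 0 a * n 0 b.
Proof.
rewrite invmx_frame -mulmxA mxE sum4; have [-> -> -> ->] := null_mx_row b.
rewrite ![_^T a _]mxE; have [-> -> -> ->] := mx4E (m 0) (p 0) (n 0) (k 0) a.
by [].
Qed.

Lemma frame_span v : v = inner G y v p *: m + inner G y v m *: p
  + inner G y v k *: n + inner G y v n *: k.
Proof.
have [e0 e1 e2 e3] := frame_row.
rewrite -[LHS]mulmx1 -frame_mxK !mulmxA -mulmxA; apply/rowP=> j.
rewrite mxE sum4; have [-> -> -> ->] := null_mx_row j.
have vE i : (v *m G y *m E^T) 0 i = inner G y v (row i E).
  by rewrite /inner !mxE; apply: eq_bigr => a _; rewrite !mxE.
by rewrite !vE e0 e1 e2 e3 !mxE; ring.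
Qed.

Variable vol : 'rV[R]_4 -> K.

(** Inserting rows of [E] into all four slots of the Levi-Civita symbol multiplies it by [\det E].
    Apart from this ([dE]), the proof only reorders one multiple sum. *)
Lemma dual_form_frame X :
  E *m dual_form vol y (E^T *m X *m E) *m E^T = (vol y * \det E) *: star4 X.
Proof.
have dE a b i j : \det (mx4 (E a) (E b) (E i) (E j)) = levi_civita a b i j * \det E.
  rewrite levi_civitaE -det_mulmx; congr determinant; apply/matrixP=> r s.
  rewrite [RHS]mxE; move: r; apply: ord4P; rewrite !mxE /=.
  - by rewrite -[LHS](sum_delta (fun f => E f s)); apply: eq_bigr => f _;
      rewrite !mxE /= /unit4 eq_sym.
  - by rewrite -[LHS](sum_delta (fun f => E f s)); apply: eq_bigr => f _;
      rewrite !mxE /= /unit4 eq_sym.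
  - by rewrite -[LHS](sum_delta (fun f => E f s)); apply: eq_bigr => f _;
      rewrite !mxE /= /unit4 eq_sym.
  - by rewrite -[LHS](sum_delta (fun f => E f s)); apply: eq_bigr => f _;
      rewrite !mxE /= /unit4 eq_sym.
have XE c d : (E^T *m X *m E) c d = \sum_(q : 'I_4 * 'I_4) E q.1 c * X q.1 q.2 * E q.2 d.
  rewrite -(pair_big xpredT xpredT (fun i j => E i c * X i j * E j d)) exchange_big mxE.
  apply: eq_bigr => j _; rewrite mxE mulr_suml; apply: eq_bigr => i _.
  by rewrite [_^T c i]mxE.
apply/matrixP=> a b; rewrite [RHS]mxE [star4 X a b]mxE.
move: (\det E) dE => dt dE.
have -> : vol y * dt * (2^-1 * \sum_c \sum_d levi_civita a b c d * X c d)
  = \sum_(q : 'I_4 * 'I_4) \sum_f \sum_l \sum_c \sum_d 2^-1 * vol y * X q.1 q.2 *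
      (levi_civita f l c d * E q.2 d * E q.1 c * E b l * E a f).
  rewrite pair_big !mulr_sumr; apply: eq_bigr => q _ /=.
  rewrite [LHS](_ : _ = 2^-1 * vol y * X q.1 q.2 * (levi_civita a b q.1 q.2 * dt)); last by ring.
  rewrite -dE -levi_civita_det mulr_sumr; apply: eq_bigr => f _.
  rewrite mulr_sumr; apply: eq_bigr => l _.
  by rewrite mulr_sumr; apply: eq_bigr => c _; rewrite mulr_sumr.
rewrite [RHS]exchange_big [LHS]mxE.
under [LHS]eq_bigr => l _.
  have -> : (E *m dual_form vol y (E^T *m X *m E)) a l =
    \sum_f E a f * dual_form vol y (E^T *m X *m E) f l by rewrite mxE.
  rewrite mulr_suml; over.
rewrite [LHS]exchange_big; apply: eq_bigr => f _; rewrite [RHS]exchange_big.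
apply: eq_bigr => l _; rewrite [RHS]exchange_big [dual_form _ _ _ f l]mxE.
rewrite [_^T l b]mxE !mulr_sumr mulr_suml; apply: eq_bigr => c _.
rewrite [RHS]exchange_big !mulr_sumr mulr_suml; apply: eq_bigr => d _.
rewrite XE; move: (levi_civita f l c d) => lc; rewrite !mulr_sumr mulr_suml; apply: eq_bigr => q _.
ring.
Qed.

Lemma wedge_frame i j : wedge (row i E) (row j E)
  = E^T *m (delta_mx i j - delta_mx j i) *m E.
Proof.
have D a b : (row a E)^T *m row b E = E^T *m delta_mx a b *m E.
  by rewrite !rowE trmx_mul trmx_delta -(mul_delta_mx (0 : 'I_1) a b) !mulmxA.
by rewrite /wedge !D mulmxBr mulmxBl.
Qed.

(** Conjugation by [H] raises both indices in the frame, which exchanges 0 with 1 and 2 with 3. *)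
Lemma null_mx_conj X : (H *m X *m H)^T = H *m X^T *m H
  /\ [/\ (H *m X *m H) i0 i1 = X i1 i0, (H *m X *m H) i0 i2 = X i1 i3,
      (H *m X *m H) i0 i3 = X i1 i2, (H *m X *m H) i1 i2 = X i0 i3
    & (H *m X *m H) i1 i3 = X i0 i2]
  /\ (H *m X *m H) i2 i3 = X i3 i2.
Proof.
have HT : H^T = H by apply/matrixP => i j; rewrite !mxE addnC.
split; first by rewrite !trmx_mul HT mulmxA.
by split; first split; rewrite mxE sum4 !mxE !sum4 !mxE /=; ring.
Qed.

Lemma frame_congr_inj X Y : E^T *m X *m E = E^T *m Y *m E -> X = Y.
Proof.
have uE := frame_mx_unit; have uET : E^T \in unitmx by rewrite unitmx_tr.
by move=> /(can_inj (mulmxK uE)) /(can_inj (mulKmx uET)).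
Qed.

Hypothesis selfdual : selfdual_plane G vol y <<[:: m; k]>>%VS.

(** The bivector of m and k equals its own dual; comparing the one component that can be nonzero
    fixes the volume of the frame, sign included. *)
Lemma adapted_volume : vol y * \det E = 1.
Proof.
have [e0 _ _ e3] := frame_row.
have mN : m \in <<[:: m; k]>>%VS by apply: memv_span; rewrite !inE eqxx.
have kN : k \in <<[:: m; k]>>%VS by apply: memv_span; rewrite !inE eqxx orbT.
have := selfdual mN kN; rewrite -e0 -e3 wedge_frame /hodge_bivector.
set Om : 'M[K]_4 := (X in E^T *m X *m E); rewrite invmx_frame.
have -> : (E^T *m H *m E)^T = E^T *m H *m E by rewrite -invmx_frame trmx_inv symG.
have -> : E^T *m H *m E *m dual_form vol y (E^T *m Om *m E) *m (E^T *m H *m E)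
  = E^T *m (H *m (E *m dual_form vol y (E^T *m Om *m E) *m E^T) *m H) *m E.
  by rewrite !mulmxA.
rewrite dual_form_frame => /frame_congr_inj; rewrite -scalemxAr -scalemxAl.
have OmT : Om^T = - Om by rewrite /Om linearB /= !trmx_delta opprB.
have [[_ _ _ s12 _] _] := star4E OmT.
have [_ [[_ _ h _ _] _]] := null_mx_conj (star4 Om).
(* Entry (0, 3) is the component along m and k. *)
move=> /matrixP/(_ i0 i3); rewrite [LHS]mxE h s12.
by rewrite /Om !mxE /= subr0 mulr1.
Qed.

(** On frame components the star fixes mk and pn, negates mn and pk, and sends mp to minus nk. The
    three conditions thus say that the component in the +1 eigenspace is zero. *)
Lemma hodge_form_antiselfdual F : F^T = - F ->
  let c u v := (u *m F *m v^T) 0 0 in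
  c m k = 0 -> c p n = 0 -> c m p = c n k -> hodge_form G vol y F = - F.
Proof.
move=> FT c cmk cpn cmp; have [e0 e1 e2 e3] := frame_row.
set Phi := E *m F *m E^T.
have PhiE i j : Phi i j = c (row i E) (row j E) by exact: row_inner.
have PhiT : Phi^T = - Phi by rewrite /Phi !trmx_mul trmxK FT mulNmx mulmxN mulmxA.
have HPhiT : (H *m Phi *m H)^T = - (H *m Phi *m H).
  by have [-> _] := null_mx_conj Phi; rewrite PhiT mulmxN mulNmx.
have uE := frame_mx_unit; have uET : E^T \in unitmx by rewrite unitmx_tr.
apply: (can_inj (mulKmx uE)); apply: (can_inj (mulmxK uET)) => /=.
rewrite mulmxN mulNmx -/Phi /hodge_form invmx_frame.
have -> : (E^T *m H *m E)^T = E^T *m H *m E by rewrite -invmx_frame trmx_inv symG.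
have -> : E^T *m H *m E *m F *m (E^T *m H *m E) = E^T *m (H *m Phi *m H) *m E.
  by rewrite /Phi !mulmxA.
rewrite dual_form_frame adapted_volume scale1r.
have [[s01 s02 s03 s12 s13] [s23 sT s0]] := star4E HPhiT.
have [_ [[h01 h02 h03 h12 h13] h23]] := null_mx_conj Phi.
have asym_entry (X : 'M[K]_4) i j : X^T = - X -> X i j = - X j i.
  by move=> /matrixP/(_ j i); rewrite !mxE.
have asym i j := asym_entry _ i j PhiT; have sasym i j := asym_entry _ i j sT.
have P03 : Phi i0 i3 = 0 by rewrite PhiE e0 e3.
have P12 : Phi i1 i2 = 0 by rewrite PhiE e1 e2.
have P01 : Phi i0 i1 = Phi i2 i3 by rewrite !PhiE e0 e1 e2 e3.
have P00 i : Phi i i = 0 by apply: double_eq0; rewrite {1}asym addNr.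
have le (i j : 'I_4) : (i < j)%N -> star4 (H *m Phi *m H) i j = - Phi i j.
  move: i j; apply: ord4P; apply: ord4P => // _.
  - by rewrite s01 h23 asym P01.
  - by rewrite s02 h13.
  - by rewrite s03 h12 P03 oppr0.
  - by rewrite s12 h03 P12 oppr0.
  - by rewrite s13 h02.
  - by rewrite s23 h01 asym P01.
apply/matrixP=> i j; rewrite [RHS]mxE; case: (ltngtP i j) => ij.
- exact: le.
- by rewrite sasym le// -asym.
- by rewrite (val_inj ij) s0 P00 oppr0.
Qed.

End Frame.
End NullFrame.

(** * The divergence identity for a smooth metric *)

Section LocalGeometry.
Variable R : realType.
Local Notation K := R[i].
Variables (G : 'rV[R]_4 -> 'M[K]_4) (V : {V : set 'rV[R]_4 | open V}).
Hypothesis smoothG : cmxsmooth_on (sval V) G.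
Hypothesis symG : forall y, sval V y -> (G y)^T = G y.
Hypothesis unitG : forall y, sval V y -> G y \in unitmx.
Implicit Types (a b c d e : 'I_4) (y z : 'rV[R]_4).

Local Notation A := (csmooth_fun V).

(* The metric is replaced by the identity outside [V], to have an inverse in
   the ring of functions. *)
Definition patch (X : 'rV[R]_4 -> 'M[K]_4) y : 'M[K]_4 :=
  if pselect (sval V y) then X y else 1%:M.

Lemma patchE X y : sval V y -> patch X y = X y.
Proof. by rewrite /patch; case: pselect. Qed.

Lemma patch_out X y : ~ sval V y -> patch X y = 1%:M.
Proof. by rewrite /patch; case: pselect. Qed.

Lemma patch_smooth X a b : cmxsmooth_on (sval V) X ->
  csmooth_on (sval V) (fun y => patch X y a b).
Proof.
move=> sX; apply: (eq_csmooth_on (svalP V) _ (sX a b)) => y Vy.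
by rewrite patchE.
Qed.

Definition metric_fun : 'M[A]_4 := \matrix_(a, b) CSmooth (patch_smooth a b smoothG).

Definition inverse_fun : 'M[A]_4 :=
  \matrix_(a, b) CSmooth (patch_smooth a b (cmxsmooth_inv (svalP V) smoothG unitG)).

Local Notation g := metric_fun.
Local Notation gi := inverse_fun.
Local Notation D := (@fun_partial R V).
Local Notation half := (fun_cst V 2^-1).
Local Notation twelfth := (fun_cst V 12^-1).

Lemma metric_funE a b y : sval V y -> g a b y = G y a b.
Proof. by move=> Vy; rewrite mxE /= patchE. Qed.

Lemma inverse_funE a b y : sval V y -> gi a b y = invmx (G y) a b.
Proof. by move=> Vy; rewrite mxE /= patchE. Qed.

Lemma metric_fun_sym a b : g a b = g b a.
Proof.
apply: csmooth_fun_eq => y; rewrite !mxE /=; have [Vy|nVy] := pselect (sval V y).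
  by rewrite patchE// -{1}symG// mxE.
by rewrite patch_out// !mxE eq_sym.
Qed.

Lemma csmooth_nat (m : nat) y : (m%:R : A) y = m%:R.
Proof. exact: (rmorph_nat (fun_eval y : {rmorphism A -> K})). Qed.

Lemma metric_fun_inverse : g *m gi = 1%:M.
Proof.
apply/matrixP=> a b; apply: csmooth_fun_eq => y.
rewrite [(1%:M : 'M[A]_4) a b]mxE csmooth_nat mxE -[LHS]/(fun_eval y _) rmorph_sum /=.
transitivity ((patch G y *m patch (fun y => invmx (G y)) y) a b).
  by rewrite mxE; apply: eq_bigr => c _; rewrite -[LHS]/(g a c y * gi c b y) !mxE.
have [Vy|nVy] := pselect (sval V y); last by rewrite !patch_out// mul1mx mxE.
by rewrite !patchE// mulmxV ?unitG// mxE.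
Qed.

Lemma fun_half2 : half * 2 = 1.
Proof.
by apply: csmooth_fun_eq => y; rewrite csmooth_valM csmooth_nat /= mulVf ?pnatr_eq0.
Qed.

Lemma fun_twelfth12 : twelfth * 12 = 1.
Proof.
by apply: csmooth_fun_eq => y; rewrite csmooth_valM csmooth_nat /= mulVf ?pnatr_eq0.
Qed.

Lemma fun_eval_partial i (f : A) (h : 'rV[R]_4 -> K) y :
  (forall z, sval V z -> f z = h z) -> sval V y ->
  fun_eval y (D i f) = cpartial i h y.
Proof.
move=> fh Vy; rewrite /fun_eval fun_partialE//; exact: (eq_cpartial (svalP V)).
Qed.

Local Notation chr' := (chr D half g gi).

Lemma chrE a b c y : sval V y -> fun_eval y (chr' a b c) = christoffel G a b c y.
Proof.
move=> Vy; rewrite rmorphM rmorph_sum /christoffel; congr (_ * _).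
apply: eq_bigr => d _; rewrite rmorphM /= {1}/fun_eval inverse_funE//; congr (_ * _).
rewrite rmorphB rmorphD /=.
by congr (_ + _ - _); apply: fun_eval_partial => // z Vz; rewrite metric_funE.
Qed.

Lemma rmuE a b c d y : sval V y ->
  fun_eval y (rmu D half g gi a b c d) = riemann_up G a b c d y.
Proof.
move=> Vy; rewrite /rmu rmorphD rmorphB rmorph_sum /riemann_up.
congr (_ - _ + _).
- by apply: fun_eval_partial => // z Vz; exact: chrE.
- by apply: fun_eval_partial => // z Vz; exact: chrE.
- by apply: eq_bigr => e _; rewrite rmorphB; congr (_ - _); rewrite rmorphM /= !chrE.
Qed.

Lemma riemannE a b c d y : sval V y ->
  fun_eval y (rm D half g gi a b c d) = riemann G a b c d y.
Proof.
move=> Vy; rewrite /rm rmorph_sum; apply: eq_bigr => e _.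
by rewrite rmorphM /= rmuE// {1}/fun_eval metric_funE.
Qed.

Lemma ricE a b y : sval V y ->
  fun_eval y (ric D half g gi a b) = ricci G a b y.
Proof. by move=> Vy; rewrite /ric rmorph_sum; apply: eq_bigr => c _; exact: rmuE. Qed.

Lemma scalE y : sval V y -> fun_eval y (scal D half g gi) = scalar_curvature G y.
Proof.
move=> Vy; rewrite /scal rmorph_sum; apply: eq_bigr => a _; rewrite rmorph_sum.
by apply: eq_bigr => b _; rewrite rmorphM /= ricE// {1}/fun_eval inverse_funE.
Qed.

Lemma schE a b y : sval V y ->
  fun_eval y (sch D half twelfth g gi a b) = schouten G a b y.
Proof.
move=> Vy; rewrite /sch rmorphB rmorphM /= ricE//; congr (_ - _).
by rewrite rmorphM (rmorphM _ _ (scal _ _ _ _)) /= scalE// {2}/fun_eval metric_funE.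
Qed.

Lemma weylE a b c d y : sval V y ->
  fun_eval y (weyl_tensor D half twelfth g gi a b c d) = weyl G a b c d y.
Proof.
move=> Vy; have gE u v := metric_funE u v Vy.
have gsE u v w x : fun_eval y (g u v * sch D half twelfth g gi w x)
    = G y u v * schouten G w x y.
  by rewrite rmorphM /= schE// {1}/fun_eval gE.
by rewrite /weyl_tensor rmorphB rmorphD rmorphB rmorphD /= !gsE riemannE.
Qed.

Lemma nabla_schoutenE a b c y : sval V y ->
  fun_eval y (cd2 D half g gi (sch D half twelfth g gi) a b c) = nabla_schouten G a b c y.
Proof.
move=> Vy; rewrite /cd2 rmorphB rmorph_sum /nabla_schouten; congr (_ - _).
  by apply: fun_eval_partial => // z Vz; exact: schE.
by apply: eq_bigr => e _; rewrite rmorphD; congr (_ + _); rewrite rmorphM /= chrE// schE.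
Qed.

Local Notation W := (weyl_tensor D half twelfth g gi).

Ltac ring_of_functions := first [exact: fun_partialD | exact: fun_partialM
  | exact: fun_partialC | exact: fun_half2 | exact: fun_twelfth12
  | exact: metric_fun_sym | exact: metric_fun_inverse].

Lemma metric_fun_parallel e a b : cd2 D half g gi g e a b = 0.
Proof. by apply: cd2G; ring_of_functions. Qed.

Lemma weyl_symmetries a b c d y : sval V y ->
  [/\ weyl G b a c d y = - weyl G a b c d y, weyl G a b d c y = - weyl G a b c d y,
      weyl G c d a b y = weyl G a b c d y
    & weyl G a b c d y + weyl G a c d b y + weyl G a d b c y = 0].
Proof.
move=> Vy; rewrite -!weylE// -!rmorphN -!rmorphD; split.
- by congr (fun_eval y); apply: weyl_asym12; ring_of_functions.
- by congr (fun_eval y); apply: weyl_asym34; ring_of_functions.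
- by congr (fun_eval y); apply: weyl_pair; ring_of_functions.
- transitivity (fun_eval y (0 : A)); last by [].
  congr (fun_eval y).
  by apply: weyl_cycle; ring_of_functions.
Qed.

Lemma weyl_traceE b d y : sval V y ->
  \sum_a \sum_c invmx (G y) a c * weyl G a b c d y = 0.
Proof.
move=> Vy; transitivity (fun_eval y (contr gi (fun a c => W a b c d))).
  rewrite rmorph_sum; apply: eq_bigr => a _; rewrite rmorph_sum; apply: eq_bigr => c _.
  by rewrite rmorphM /= weylE// {1}/fun_eval inverse_funE.
transitivity (fun_eval y (0 : A)); last by [].
  congr (fun_eval y).
by apply: weyl_trace; ring_of_functions.
Qed.

Lemma cottonE b c d y : sval V y ->
  \sum_e \sum_a invmx (G y) e a * fun_eval y (cd4 D half g gi W e a b c d)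
  = cotton G b c d y.
Proof.
move=> Vy.
transitivity (fun_eval y (contr gi (fun e a => cd4 D half g gi W e a b c d))).
  rewrite rmorph_sum; apply: eq_bigr => e _; rewrite rmorph_sum; apply: eq_bigr => a _.
  by rewrite rmorphM /= {2}/fun_eval inverse_funE.
rewrite /cotton -!nabla_schoutenE// -rmorphB; congr (fun_eval y).
by apply: div_weyl; ring_of_functions.
Qed.

Lemma weyl_atE y X Y Z T :
  weyl_at G y X Y Z T = ev4 (fun a b c d => weyl G a b c d y) (X 0) (Y 0) (Z 0) (T 0).
Proof. by rewrite ev4E. Qed.

Lemma weyl_curvature_form y : sval V y -> curvature_form (weyl_at G y).
Proof.
move=> Vy; have sym a b c d := weyl_symmetries a b c d Vy.
split=> [r x x' z w t|x z w t|x z w t|x z w t|x z w t]; rewrite !weyl_atE.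
- rewrite /ev4 /ev1 mulr_sumr -big_split; apply: eq_bigr => a _ /=.
  by rewrite !mxE mulrDl mulrA.
- rewrite ev4_swap12 -ev4N; apply: eq_ev4 => a b c d.
  by have [] := sym a b c d.
- rewrite ev4_swap34 -ev4N; apply: eq_ev4 => a b c d.
  by have [] := sym a b c d.
(* The exchange of the two pairs is a product of the four adjacent transpositions 23, 12, 34, 23. *)
- rewrite [LHS]ev4_swap23 [LHS]ev4_swap12 [LHS]ev4_swap34 [LHS]ev4_swap23.
  by apply: eq_ev4 => a b c d; have [] := sym a b c d.
- rewrite [X in _ + X + _]ev4_swap34 [X in _ + X + _]ev4_swap23.
  rewrite [X in _ + _ + X]ev4_swap23 [X in _ + _ + X]ev4_swap34.
  by rewrite -!ev4D; apply: ev40 => a b c d; have [] := sym a b c d.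
Qed.

Lemma weyl_trace_free y m p n k : sval V y -> null_frame G y m p n k ->
  trace_free (weyl_at G y) m p n k.
Proof.
move=> Vy nf x z.
have giE := invmx_frameE (symG Vy) (unitG Vy) nf.
transitivity (\sum_b \sum_d x 0 b * z 0 d *
    \sum_a \sum_c invmx (G y) a c * weyl G a b c d y); last first.
  by apply: big1 => b _; apply: big1 => d _; rewrite weyl_traceE// mulr0.
under [RHS]eq_bigr => b _.
  under eq_bigr => d _.
    rewrite mulr_sumr; under eq_bigr do rewrite mulr_sumr.
    over.
  rewrite exchange_big; under eq_bigr do rewrite exchange_big.
  over.
rewrite [RHS]exchange_big /weyl_at -!big_split; apply: eq_bigr => a _ /=.
rewrite -!big_split; apply: eq_bigr => b _ /=.
rewrite -!big_split; apply: eq_bigr => c _ /=.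
rewrite -!big_split; apply: eq_bigr => d _ /=.
by rewrite giE; ring.
Qed.

End LocalGeometry.

(** * Covariant derivatives at a point and the rotation of a totally null plane field *)

Section PlaneField.
Variable R : realType.
Local Notation K := R[i].
Variables (G : 'rV[R]_4 -> 'M[K]_4) (V : {V : set 'rV[R]_4 | open V}).
Hypothesis smoothG : cmxsmooth_on (sval V) G.
Hypothesis symG : forall y, sval V y -> (G y)^T = G y.
Hypothesis unitG : forall y, sval V y -> G y \in unitmx.
Implicit Types (a b c d e : 'I_4) (y z : 'rV[R]_4) (u v w x t : 'rV[K]_4).

Local Notation A := (csmooth_fun V).
Local Notation g := (metric_fun smoothG).
Local Notation gi := (inverse_fun smoothG unitG).
Local Notation D := (@fun_partial R V).
Local Notation half := (fun_cst V 2^-1).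
Local Notation twelfth := (fun_cst V 12^-1).
Local Notation W := (weyl_tensor D half twelfth g gi).

Definition field_fun (X : 'rV[R]_4 -> 'rV[K]_4) (sX : cmxsmooth_on (sval V) X) a : A :=
  CSmooth (sX 0 a).

Lemma cst_smooth u : cmxsmooth_on (sval V) (fun=> u).
Proof. by move=> i j; exact: csmooth_cst (svalP V) _. Qed.

Lemma fun_partial_near0 (f : A) e y : sval V y -> (\forall z \near y, f z = 0) ->
  fun_eval y (D e f) = 0.
Proof.
move=> Vy f0; rewrite /fun_eval fun_partialE// /cpartial.
have part0 (h : 'rV[R]_4 -> R) : (\forall z \near y, h z = 0) -> partial e h y = 0.
  by move=> h0; rewrite -(partial_cst 0 e y); exact: near_eq_derive.
by rewrite !part0//; apply: filterS f0 => z ->.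
Qed.

Definition nabla X (sX : cmxsmooth_on (sval V) X) e y : 'rV[K]_4 :=
  \row_a fun_eval y (cd1 D half g gi (field_fun sX) e a).

(** The direction is a mere vector at [y], so that vectors of a pointwise frame need no extension to
    fields. *)
Definition nabla_along X (sX : cmxsmooth_on (sval V) X) y v : 'rV[K]_4 :=
  \sum_e v 0 e *: nabla sX e y.

Definition nabla_weyl y v u w x t : K :=
  \sum_e v 0 e * ev4 (fun a b c d => fun_eval y (cd4 D half g gi W e a b c d))
    (u 0) (w 0) (x 0) (t 0).

Lemma inner_ev2 y v w : inner G y v w = ev2 (fun a b => G y a b) (v 0) (w 0).
Proof.
rewrite /inner mxE; under eq_bigr do rewrite mxE mulr_suml.
rewrite exchange_big; apply: eq_bigr => a _; rewrite /ev1 mulr_sumr.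
by apply: eq_bigr => b _; rewrite !mxE; ring.
Qed.

Lemma inner_suml y (f : 'I_4 -> 'rV[K]_4) w :
  inner G y (\sum_e f e) w = \sum_e inner G y (f e) w.
Proof. by rewrite /inner !mulmx_suml summxE. Qed.

(** The derivative at [y] of the function g(X, Y), which vanishes nearby, with [metric_fun_parallel]
    removing the term in the derivative of the metric. *)
Lemma nabla_inner X Y (sX : cmxsmooth_on (sval V) X) (sY : cmxsmooth_on (sval V) Y) y v :
  sval V y -> (\forall z \near y, inner G z (X z) (Y z) = 0) ->
  inner G y (nabla_along sX y v) (Y y) = - inner G y (X y) (nabla_along sY y v).
Proof.
move=> Vy XY0.
have sumR (f : 'I_4 -> 'rV[K]_4) w : inner G y w (\sum_e f e) = \sum_e inner G y w (f e).
  by rewrite innerC ?symG// inner_suml; apply: eq_bigr => e _; rewrite innerC ?symG.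
rewrite /nabla_along inner_suml sumR -sumrN; apply: eq_bigr => e _.
rewrite innerZl innerZr ?symG// -mulrN; congr (_ * _); apply/eqP.
rewrite -subr_eq0 opprK; apply/eqP.
transitivity (fun_eval y (D e (ev2 (fun a b => g a b) (field_fun sX) (field_fun sY)))).
  rewrite (der_ev2 half g gi (@fun_partialD _ _) (@fun_partialM _ _)).
  have -> : ev2 (cd2 D half g gi (fun a b => g a b) e) (field_fun sX) (field_fun sY) = 0.
    apply: big1 => a _; rewrite [ev1 _ _]big1 ?mulr0// => b _.
    rewrite (_ : cd2 _ _ _ _ _ _ _ _ = 0) ?mulr0//.
    by apply: metric_fun_parallel.
  rewrite add0r rmorphD !rmorph_ev2 !inner_ev2; congr (_ + _).
    apply: eq_ev1 => a; first by rewrite mxE.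
    by apply: eq_ev1 => // b; symmetry; exact: metric_funE.
  apply: eq_ev1 => // a; apply: eq_ev1 => b; first by rewrite mxE.
  by symmetry; exact: metric_funE.
apply: fun_partial_near0 => //.
have nearV : \forall z \near y, sval V z by exact: open_nbhs_nbhs (conj (svalP V) Vy).
apply: filterS2 XY0 nearV => z <- Vz; rewrite -[LHS]/(fun_eval z _) rmorph_ev2 inner_ev2.
by apply: eq_ev1 => // a; apply: eq_ev1 => // b; exact: metric_funE.
Qed.

(** The Leibniz rule for C(X, Y, Z, T), a function that vanishes near [y] and so has zero partial
    derivatives there. *)
Lemma nabla_weylE X Y Z T (sX : cmxsmooth_on (sval V) X) (sY : cmxsmooth_on (sval V) Y)
    (sZ : cmxsmooth_on (sval V) Z) (sT : cmxsmooth_on (sval V) T) y v :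
  sval V y -> (\forall z \near y, weyl_at G z (X z) (Y z) (Z z) (T z) = 0) ->
  nabla_weyl y v (X y) (Y y) (Z y) (T y)
  + weyl_at G y (nabla_along sX y v) (Y y) (Z y) (T y)
  + weyl_at G y (X y) (nabla_along sY y v) (Z y) (T y)
  + weyl_at G y (X y) (Y y) (nabla_along sZ y v) (T y)
  + weyl_at G y (X y) (Y y) (Z y) (nabla_along sT y v) = 0.
Proof.
move=> Vy C0; have hC := weyl_curvature_form smoothG symG unitG Vy.
have nearV : \forall z \near y, sval V z by exact: open_nbhs_nbhs (conj (svalP V) Vy).
have sum1 (f : 'I_4 -> 'rV[K]_4) w x t :
    weyl_at G y (\sum_e f e) w x t = \sum_e weyl_at G y (f e) w x t.
  apply: (big_morph (fun u => weyl_at G y u w x t)) => [u u'|]; first exact: formD.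
  exact: form0.
have sum2 (f : 'I_4 -> 'rV[K]_4) w x t :
    weyl_at G y w (\sum_e f e) x t = \sum_e weyl_at G y w (f e) x t.
  rewrite (form_asym12 hC) sum1 -sumrN; apply: eq_bigr => e _.
  by rewrite -(form_asym12 hC).
have sum3 (f : 'I_4 -> 'rV[K]_4) w x t :
    weyl_at G y w x (\sum_e f e) t = \sum_e weyl_at G y w x (f e) t.
  by rewrite (form_pair hC) sum1; apply: eq_bigr => e _; rewrite (form_pair hC w x).
have sum4 (f : 'I_4 -> 'rV[K]_4) w x t :
    weyl_at G y w x t (\sum_e f e) = \sum_e weyl_at G y w x t (f e).
  by rewrite (form_pair hC) sum2; apply: eq_bigr => e _; rewrite (form_pair hC w x).
rewrite /nabla_along sum1 sum2 sum3 sum4 /nabla_weyl -!big_split; apply: big1 => e _ /=.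
rewrite (formZ hC) (formZ2 hC) (formZ3 hC) (formZ4 hC) -!mulrDr.
suff -> : ev4 (fun a b c d => fun_eval y (cd4 D half g gi W e a b c d))
      ((X y) 0) ((Y y) 0) ((Z y) 0) ((T y) 0)
    + weyl_at G y (nabla sX e y) (Y y) (Z y) (T y)
    + weyl_at G y (X y) (nabla sY e y) (Z y) (T y)
    + weyl_at G y (X y) (Y y) (nabla sZ e y) (T y)
    + weyl_at G y (X y) (Y y) (Z y) (nabla sT e y) = 0 by rewrite mulr0.
transitivity (fun_eval y (D e (ev4 W (field_fun sX) (field_fun sY) (field_fun sZ)
    (field_fun sT)))); last first.
  apply: fun_partial_near0 => //; apply: filterS2 C0 nearV => z <- Vz.
  rewrite -[LHS]/(fun_eval z _) rmorph_ev4 weyl_atE; apply: eq_ev4 => a b c d.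
  exact: weylE.
rewrite (der_ev4 half g gi (@fun_partialD _ _) (@fun_partialM _ _)) !rmorphD.
have Wy a b c d : fun_eval y (W a b c d) = weyl G a b c d y by exact: weylE.
rewrite !weyl_atE; congr (_ + _ + _ + _ + _); rewrite rmorph_ev4 //.
all: apply: eq_ev1 => a; first by rewrite ?mxE.
all: apply: eq_ev1 => b; first by rewrite ?mxE.
all: rewrite /ev2; apply: eq_ev1 => c; first by rewrite ?mxE.
all: by apply: eq_ev1 => d; [rewrite ?mxE | rewrite -Wy].
Qed.

(** The four terms trace the direction of differentiation against the first slot of the Weyl tensor,
    as the inverse metric is mp + pm + nk + kn; [cottonE] then applies. *)
Lemma nabla_weyl_div m p n k y u w x : sval V y -> null_frame G y m p n k ->
  nabla_weyl y m p u w x + nabla_weyl y p m u w x + nabla_weyl y n k u w x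
  + nabla_weyl y k n u w x = cotton_at G y u w x.
Proof.
move=> Vy nf; have giE := invmx_frameE (symG Vy) (unitG Vy) nf.
pose T e a b c d := fun_eval y (cd4 D half g gi W e a b c d).
transitivity (\sum_(q : 'I_4 * 'I_4) \sum_b \sum_c \sum_d
    invmx (G y) q.1 q.2 * T q.1 q.2 b c d * u 0 b * w 0 c * x 0 d).
  rewrite /nabla_weyl -!big_split -(pair_big xpredT xpredT (fun e a =>
    \sum_b \sum_c \sum_d invmx (G y) e a * T e a b c d * u 0 b * w 0 c * x 0 d)) /=.
  apply: eq_bigr => e _; rewrite !ev4E !mulr_sumr -!big_split; apply: eq_bigr => a _ /=.
  rewrite !mulr_sumr -!big_split; apply: eq_bigr => b _ /=.
  rewrite !mulr_sumr -!big_split; apply: eq_bigr => c _ /=.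
  rewrite !mulr_sumr -!big_split; apply: eq_bigr => d _ /=.
  by rewrite giE -/(T e a b c d); ring.
rewrite exchange_big; apply: eq_bigr => b _; rewrite exchange_big; apply: eq_bigr => c _.
rewrite exchange_big; apply: eq_bigr => d _; rewrite -(cottonE smoothG symG unitG)//.
rewrite pair_bigA /= !mulr_suml; apply: eq_bigr => q _.
by rewrite /T.
Qed.

Lemma mem_span2 v w u :
  u \in <<[:: v; w]>>%VS <-> exists s t : K, u = s *: v + t *: w.
Proof.
rewrite span_cons span_seq1; split=> [/memv_addP[_ /vlineP[s ->] [_ /vlineP[t ->] ->]]|].
  by exists s, t.
by move=> [s [t ->]]; apply: memv_add; exact: memvZ (memv_line _).
Qed.

Lemma lie_bracketE X Y (sX : cmxsmooth_on (sval V) X) (sY : cmxsmooth_on (sval V) Y) y :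
  sval V y ->
  lie_bracket X Y y = nabla_along sY y (X y) - nabla_along sX y (Y y).
Proof.
move=> Vy; apply/rowP=> a; rewrite mxE.
transitivity (fun_eval y (bracket D (field_fun sX) (field_fun sY) a)).
  rewrite rmorph_sum; apply: eq_bigr => b _; rewrite rmorphB; congr (_ - _).
    by rewrite rmorphM; congr (_ * _); rewrite /= /fun_eval fun_partialE.
  by rewrite rmorphM; congr (_ * _); rewrite /= /fun_eval fun_partialE.
rewrite (bracketE D half gi (metric_fun_sym smoothG symG)) rmorph_sum !mxE !summxE.
rewrite -sumrB; apply: eq_bigr => b _; rewrite rmorphB.
by congr (_ - _); rewrite rmorphM !mxE.
Qed.

Section NullPlane.
Variables X1 X2 : 'rV[R]_4 -> 'rV[K]_4.
Hypothesis smooth1 : cmxsmooth_on (sval V) X1.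
Hypothesis smooth2 : cmxsmooth_on (sval V) X2.
Hypothesis null11 : forall z, sval V z -> inner G z (X1 z) (X1 z) = 0.
Hypothesis null12 : forall z, sval V z -> inner G z (X1 z) (X2 z) = 0.
Hypothesis null22 : forall z, sval V z -> inner G z (X2 z) (X2 z) = 0.

(* [g(nabla_X X1, X2)]; the plane field is integrable iff this vanishes for X = X1, X2. *)
Definition rotation_fun X (sX : cmxsmooth_on (sval V) X) : A :=
  ev1 (field_fun sX) (fun e => ev2 (fun a b => g a b)
    (cd1 D half g gi (field_fun smooth1) e) (field_fun smooth2)).

(** The sigma of the argument, at a point and along a vector. Its version in the ring,
    [rotation_fun], serves to show that being nonzero is an open condition. *)
Definition rotation y v : K := inner G y (nabla_along smooth1 y v) (X2 y).

Lemma rotation_funE X (sX : cmxsmooth_on (sval V) X) y : sval V y ->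
  rotation_fun sX y = rotation y (X y).
Proof.
move=> Vy; transitivity (fun_eval y (rotation_fun sX)); first by [].
rewrite /rotation_fun rmorph_ev1 /rotation /nabla_along inner_suml.
apply: eq_bigr => e _; rewrite innerZl inner_ev2; congr (_ * _); rewrite rmorph_ev2.
apply: eq_ev1 => a; first by rewrite mxE.
by apply: eq_ev1 => // b; exact: metric_funE.
Qed.

Lemma rotation_linear y v w (s t : K) :
  rotation y (s *: v + t *: w) = s * rotation y v + t * rotation y w.
Proof.
have E : nabla_along smooth1 y (s *: v + t *: w)
    = s *: nabla_along smooth1 y v + t *: nabla_along smooth1 y w.
  rewrite /nabla_along !scaler_sumr -big_split; apply: eq_bigr => e _ /=.
  by rewrite !mxE scalerDl !scalerA.
by rewrite /rotation E innerDl !innerZl.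
Qed.

Variables (y : 'rV[R]_4) (p n : 'rV[K]_4).
Hypothesis Vy : sval V y.
Hypothesis nf : null_frame G y (X1 y) p n (X2 y).

Let nearV : \forall z \near y, sval V z.
Proof. by exact: open_nbhs_nbhs (conj (svalP V) Vy). Qed.

Lemma nabla1_null v : inner G y (nabla_along smooth1 y v) (X1 y) = 0.
Proof.
have := nabla_inner smooth1 smooth1 v Vy (filterS null11 nearV).
rewrite (innerC (symG Vy) (X1 y)) => E.
by apply: double_eq0; rewrite {1}E addNr.
Qed.

Lemma nabla2_null v : inner G y (nabla_along smooth2 y v) (X2 y) = 0.
Proof.
have := nabla_inner smooth2 smooth2 v Vy (filterS null22 nearV).
rewrite (innerC (symG Vy) (X2 y)) => E.
by apply: double_eq0; rewrite {1}E addNr.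
Qed.

Lemma nabla2_rotation v : inner G y (nabla_along smooth2 y v) (X1 y) = - rotation y v.
Proof.
have null21 z : sval V z -> inner G z (X2 z) (X1 z) = 0.
  by move=> Vz; rewrite innerC ?null12 ?symG.
rewrite (nabla_inner smooth2 smooth1 v Vy (filterS null21 nearV)).
by rewrite (innerC (symG Vy)).
Qed.

(** In [frame_span] the coefficient of [p] is g(nabla_v X1, X1), zero because X1 is null, and that
    of [n] is g(nabla_v X1, X2). *)
Lemma nabla1E v : exists a b : K,
  nabla_along smooth1 y v = a *: X1 y + b *: X2 y + rotation y v *: n.
Proof.
have := frame_span (symG Vy) nf (nabla_along smooth1 y v).
rewrite nabla1_null scale0r addr0 -/(rotation y v) => {1}->.
by do 2 eexists; rewrite addrAC.
Qed.

Lemma nabla2E v : exists a b : K,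
  nabla_along smooth2 y v = a *: X1 y + b *: X2 y - rotation y v *: p.
Proof.
have := frame_span (symG Vy) nf (nabla_along smooth2 y v).
rewrite nabla2_null scale0r addr0 nabla2_rotation scaleNr => {1}->.
by do 2 eexists; rewrite addrAC.
Qed.

(** Differentiating g(Z, Xi) = 0 for a section Z shows that nabla_v Z stays orthogonal to the plane
    for v in it, and the plane is its own orthogonal; the bracket is a difference of two such
    derivatives. *)
Lemma lie_bracket_in_plane X Y (sX : cmxsmooth_on (sval V) X)
    (sY : cmxsmooth_on (sval V) Y) :
  (forall z, sval V z -> X z \in <<[:: X1 z; X2 z]>>%VS) ->
  (forall z, sval V z -> Y z \in <<[:: X1 z; X2 z]>>%VS) ->
  rotation y (X1 y) = 0 -> rotation y (X2 y) = 0 ->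
  lie_bracket X Y y \in <<[:: X1 y; X2 y]>>%VS.
Proof.
move=> inX inY r1 r2.
have rot0 v : v \in <<[:: X1 y; X2 y]>>%VS -> rotation y v = 0.
  by move=> /mem_span2[s [t ->]]; rewrite rotation_linear r1 r2 !mulr0 addr0.
have null21 z : sval V z -> inner G z (X2 z) (X1 z) = 0.
  by move=> Vz; rewrite innerC ?null12 ?symG.
have orth Z (sZ : cmxsmooth_on (sval V) Z) v :
    (forall z, sval V z -> Z z \in <<[:: X1 z; X2 z]>>%VS) ->
    v \in <<[:: X1 y; X2 y]>>%VS ->
    inner G y (nabla_along sZ y v) (X1 y) = 0 /\
    inner G y (nabla_along sZ y v) (X2 y) = 0.
  move=> inZ /rot0 rv; have /mem_span2[s [t Zy]] := inZ _ Vy.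
  have n1 := nabla1_null v; have n2 := nabla2_null v; have n21 := nabla2_rotation v.
  rewrite /rotation in rv n21; rewrite rv oppr0 in n21.
  split.
    rewrite (nabla_inner sZ smooth1 v Vy); last first.
      apply: filterS nearV => z Vz; have /mem_span2[s' [t' ->]] := inZ _ Vz.
      by rewrite innerDl !innerZl null11// null21// !mulr0 addr0.
    by rewrite (innerC (symG Vy)) Zy !innerDr ?symG// !innerZr ?symG// n1 rv !mulr0 addr0 oppr0.
  rewrite (nabla_inner sZ smooth2 v Vy); last first.
    apply: filterS nearV => z Vz; have /mem_span2[s' [t' ->]] := inZ _ Vz.
    by rewrite innerDl !innerZl null12// null22// !mulr0 addr0.
  by rewrite (innerC (symG Vy)) Zy !innerDr ?symG// !innerZr ?symG// n21 n2 !mulr0 addr0 oppr0.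
rewrite (lie_bracketE sX sY Vy).
have [a1 a2] := orth _ sY _ inY (inX _ Vy); have [b1 b2] := orth _ sX _ inX (inY _ Vy).
set v := _ - _.
have v1 : inner G y v (X1 y) = 0 by rewrite /v innerDl innerNl a1 b1 subrr.
have v2 : inner G y v (X2 y) = 0 by rewrite /v innerDl innerNl a2 b2 subrr.
apply/mem_span2; exists (inner G y v p), (inner G y v n).
by rewrite [LHS](frame_span (symG Vy) nf) v1 v2 !scale0r !addr0.
Qed.

Hypothesis cotton12 : forall u, cotton_at G y u (X1 y) (X2 y) = 0.
Hypothesis cotton21 : forall u, cotton_at G y u (X2 y) (X1 y) = 0.
Hypothesis aligned1 : forall z v, sval V z -> weyl_at G z (X1 z) (X2 z) (X1 z) v = 0.
Hypothesis aligned2 : forall z v, sval V z -> weyl_at G z (X1 z) (X2 z) (X2 z) v = 0.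

Let frame_facts : [/\ curvature_form (weyl_at G y),
    trace_free (weyl_at G y) (X1 y) p n (X2 y),
    forall v, exists a b c d : K, v = a *: X1 y + b *: p + c *: n + d *: X2 y,
    weyl_at G y (X1 y) (X2 y) (X1 y) (X2 y) = 0
  & weyl_at G y (X1 y) (X2 y) n (X2 y) = 0].
Proof.
have hC := weyl_curvature_form smoothG symG unitG Vy; split => //.
- exact: (weyl_trace_free smoothG).
- move=> v; rewrite [v](frame_span (symG Vy) nf).
  by do 4 eexists.
- exact: aligned1.
- by rewrite (form_asym34 hC) aligned2 ?oppr0.
Qed.

Lemma rotation_Psi2 : rotation y (X1 y) * weyl_at G y (X1 y) (X2 y) p n = 0 /\
  rotation y (X2 y) * weyl_at G y (X1 y) (X2 y) p n = 0.
Proof.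
have [hC tr span P0 P1] := frame_facts.
have C112 u z : sval V z -> weyl_at G z u (X1 z) (X1 z) (X2 z) = 0.
  move=> Vz; have hz := weyl_curvature_form smoothG symG unitG Vz.
  by rewrite -(form_pair hz) (form_asym34 hz) aligned1 ?oppr0.
have C221 u z : sval V z -> weyl_at G z u (X2 z) (X2 z) (X1 z) = 0.
  move=> Vz; have hz := weyl_curvature_form smoothG symG unitG Vz.
  by rewrite -(form_pair hz) (form_asym34 hz) (form_asym12 hz) aligned2 ?oppr0.
apply: (sigma_Psi2_plane hC tr span P0 P1 nabla1E nabla2E (nC := nabla_weyl y)).
- by move=> u; rewrite nabla_weyl_div.
- by move=> u; rewrite nabla_weyl_div.
(* [u] is extended with constant components; its covariant derivative enters only through C(., X1,
   X1, X2), which is zero by [C112]. *)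
- move=> v u; have := nabla_weylE (cst_smooth u) smooth1 smooth1 smooth2 v Vy.
  rewrite C112// addr0; apply.
  by apply: filterS nearV => z Vz; exact: C112.
- move=> v u; have := nabla_weylE (cst_smooth u) smooth2 smooth2 smooth1 v Vy.
  rewrite C221// addr0; apply.
  by apply: filterS nearV => z Vz; exact: C221.
Qed.

Lemma rotation_Psi3 :
  (\forall z \near y, forall u v, weyl_at G z u v (X1 z) (X2 z) = 0) ->
  rotation y (X1 y) * weyl_at G y p n (X1 y) p = 0 /\
  rotation y (X2 y) * weyl_at G y p n (X1 y) p = 0.
Proof.
move=> C0; have [hC tr span P0 P1] := frame_facts; have Cy := nbhs_singleton C0.
have Cy' u v : weyl_at G y u v (X2 y) (X1 y) = 0 by rewrite (form_asym34 hC) Cy oppr0.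
apply: (sigma_Psi3_plane hC tr span P0 P1 nabla1E nabla2E (nC := nabla_weyl y)).
- by move=> u; rewrite nabla_weyl_div.
- by move=> u; rewrite nabla_weyl_div.
- by rewrite (form_pair hC p n) Cy.
- move=> v u w; have := nabla_weylE (cst_smooth u) (cst_smooth w) smooth1 smooth2 v Vy.
  by rewrite !Cy !addr0; apply; apply: filterS C0 => z; exact.
- move=> v u w; have := nabla_weylE (cst_smooth u) (cst_smooth w) smooth2 smooth1 v Vy.
  rewrite !Cy' !addr0; apply; apply: filterS2 C0 nearV => z Cz Vz.
  by rewrite (form_asym34 (weyl_curvature_form smoothG symG unitG Vz)) Cz oppr0.
Qed.

End NullPlane.

End PlaneField.

(** * Principal planes and Petrov types *)

Section PrincipalPlane.
Variable R : realType.
Local Notation K := R[i].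
Variables (G : 'rV[R]_4 -> 'M[K]_4) (vol : 'rV[R]_4 -> K) (y : 'rV[R]_4).
Hypothesis symG : (G y)^T = G y.
Hypothesis unitG : G y \in unitmx.
Hypothesis hC : curvature_form (weyl_at G y).
Hypothesis tr : forall m p n k, null_frame G y m p n k ->
  trace_free (weyl_at G y) m p n k.
Implicit Types (u v w m p n k : 'rV[K]_4).

Lemma double_root (Q : {poly K}) t : ('X - t%:P) ^+ 2 %| Q ->
  Q.[t] = 0 /\ Q^`().[t] = 0.
Proof.
move=> /dvdpP[q ->]; rewrite expr2; split.
  by rewrite !hornerE subrr /= mulr0.
by rewrite !derivM !hornerE subrr /= !(mulr0, mul0r, addr0).
Qed.

(** Rotating the frame moves the principal plane to the position of span(m, k): Psi0 and Psi1 of the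
    new frame are the quartic and a quarter of its derivative at the root, so a double root
    annihilates both. *)
Lemma principal_null_frame P : multiple_principal G vol y P ->
  exists m p n k, [/\ null_frame G y m p n k, P = <<[:: m; k]>>%VS,
    weyl_at G y m k m k = 0 & weyl_at G y m k n k = 0].
Proof.
move=> [m [p [n [k [z [[nf _] -> root]]]]]].
have [[mp nk] [mm pp nn kk] [mn mk pn pk]] := nf.
have sC v w := innerC symG v w.
have Dr u v w := innerDr symG u v w; have Zr a v w := innerZr symG a v w.
have Nr v w := innerNr symG v w.
case: z root => [t /double_root[]|]; rewrite /weyl_quartic /Psi0 /Psi1 /Psi2 /Psi3 /Psi4.
  rewrite !(derivD, derivN, derivZ, derivXn, derivX, derivC) !hornerE /= => Q0 Q1.
  exists (m + t *: n), p, n, (k - t *: p).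
  have [r0 r1] := form_rotated hC (tr nf) t.
  split; [|by []|by rewrite r0 -[RHS]Q0; ring|]; last first.
    by apply: (eq_of_relation (c := 4^-1) Q1); rewrite r1; field.
  - rewrite /null_frame !(innerDl, innerNl, innerZl, Dr, Nr, Zr).
    rewrite ?(sC n m) ?(sC k m) ?(sC k n) ?(sC k p) ?(sC p m) ?(sC n p).
    rewrite ?mp ?nk ?mm ?pp ?nn ?kk ?mn ?mk ?pn ?pk.
    by split; split; ring.
rewrite /quartic_root; set Q := (X in (size X <= _)%N) => sz.
have Q4 : Q`_4 = 0 by apply: nth_default; exact: leq_trans sz _.
have Q3 : Q`_3 = 0 by apply: nth_default; exact: leq_trans sz _.
rewrite /Q !coefE /= !(mulr0, mulr1, addr0, subr0, sub0r) in Q4 Q3.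
(* At infinity a double root means that the two leading coefficients vanish; in this frame Psi4 and
   - Psi3 take the place of Psi0 and Psi1. *)
exists n, k, m, p; split => //.
- rewrite /null_frame (sC n m) (sC k m) (sC k p) (sC n p).
  by split; split.
- by rewrite (form_asym12 hC) (form_asym34 hC) opprK.
- rewrite (form_asym12 hC); apply/eqP; rewrite oppr_eq0.
  by move/eqP: Q3; rewrite oppr_eq0 mulf_eq0 pnatr_eq0.
Qed.

(** The frame witnessing principality is unrelated to the smooth sections spanning the plane; a
    change of basis in the plane, compensated on [p] and [n], brings the sections into a null
    frame. *)
Lemma principal_frame X1 X2 : multiple_principal G vol y <<[:: X1; X2]>>%VS ->
  \dim <<[:: X1; X2]>>%VS = 2%N ->
  exists p n, null_frame G y X1 p n X2
    /\ forall v, weyl_at G y X1 X2 X1 v = 0 /\ weyl_at G y X1 X2 X2 v = 0.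
Proof.
move=> /principal_null_frame[m [p [n [k [nf defP P0 P1]]]]] dim2.
have /mem_span2[a [b E1]] : X1 \in <<[:: m; k]>>%VS.
  by rewrite -defP memv_span// !inE eqxx.
have /mem_span2[c [d E2]] : X2 \in <<[:: m; k]>>%VS.
  by rewrite -defP memv_span// !inE eqxx orbT.
have fr : free [:: X1; X2] by rewrite /free dim2.
have := fr; rewrite free_cons seq1_free span_seq1 => /andP[X1n X20].
have line (s t : K) : s *: X1 = t *: X2 -> s = 0 /\ t = 0.
  move=> st; have s0 : s = 0.
    apply: contraNeq X1n => s0; apply/vlineP; exists (s^-1 * t).
    by rewrite -scalerA -st scalerA mulVf// scale1r.
  split=> //; move/esym/eqP: st.
  by rewrite s0 scale0r scaler_eq0 (negPf X20) orbF => /eqP.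
set del := a * d - b * c.
have del0 : del != 0.
  apply/negP => /eqP dl.
  have [d0 b0] : d = 0 /\ b = 0.
    apply: line; rewrite E1 E2 !scalerDr !scalerA [d * b]mulrC; congr (_ + _).
    by congr (_ *: _); apply/eqP; rewrite -subr_eq0 [d * a]mulrC -/del dl.
  have [c0 a0] : c = 0 /\ a = 0.
    apply: line; rewrite E1 E2 !scalerDr !scalerA [c * a]mulrC; congr (_ + _).
    by congr (_ *: _); apply/esym/eqP; rewrite -subr_eq0 [c * b]mulrC -/del dl.
  by move: X1n; rewrite E1 a0 b0 !scale0r addr0 mem0v.
have [[mp nk] [mm pp nn kk] [mn mk pn pk]] := nf.
(* The inverse transpose of the matrix with rows (a, b) and (c, d), acting on the dual pair p, n. *)
exists ((d / del) *: p - (c / del) *: n), ((a / del) *: n - (b / del) *: p).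
have sC v w := innerC symG v w.
have Dr u v w := innerDr symG u v w; have Zr s v w := innerZr symG s v w.
have Nr v w := innerNr symG v w.
have span v : exists a' b' c' d' : K, v = a' *: m + b' *: p + c' *: n + d' *: k.
  by rewrite [v](frame_span symG nf); do 4 eexists.
split.
  rewrite /null_frame E1 E2 !(innerDl, innerNl, innerZl, Dr, Nr, Zr).
  rewrite ?(sC n m) ?(sC k m) ?(sC k n) ?(sC k p) ?(sC p m) ?(sC n p).
  rewrite ?mp ?nk ?mm ?pp ?nn ?kk ?mn ?mk ?pn ?pk.
  by split; split; rewrite /del in del0 *; field.
move=> v; have [f1 f2] := form_aligned hC (tr nf) span P0 P1 v.
have f3 : weyl_at G y k m m v = 0 by rewrite (form_asym12 hC) f1 oppr0.
have f4 : weyl_at G y k m k v = 0 by rewrite (form_asym12 hC) f2 oppr0.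
by split; rewrite E1 E2 !(formE hC) !(form_xx12 hC) f1 f2 f3 f4; ring.
Qed.

(** Freezing the last two slots at coordinate vectors leaves a 2-form in the first two, on which
    [hodge_form] acts. *)
Lemma weyl_at_delta u v c d :
  weyl_at G y u v (delta_mx 0 c) (delta_mx 0 d)
  = (u *m (\matrix_(e, f) weyl G e f c d y) *m v^T) 0 0.
Proof.
have pick (F : 'I_4 -> K) f : \sum_a F a * (delta_mx 0 f : 'rV[K]_4) 0 a = F f.
  rewrite (bigD1 f)//= mxE !eqxx mulr1 big1 ?addr0// => a /negPf af.
  by rewrite mxE af andbF mulr0.
rewrite /weyl_at mxE.
under eq_bigr do under eq_bigr do (under eq_bigr do rewrite pick; rewrite pick).
under [RHS]eq_bigr do rewrite mxE mulr_suml.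
rewrite [RHS]exchange_big; apply: eq_bigr => a _; apply: eq_bigr => b _.
by rewrite !mxE; ring.
Qed.

(** Only the term Psi4 z^4 of the quartic is left. Either Psi4 is nonzero and z = 0 is a quadruple
    root, or all five Psi vanish and the Weyl tensor is antiselfdual, so that C + *C = 0. *)
Lemma type_N_or_0 m p n k :
  (forall a b c d, weyl G b a c d y = - weyl G a b c d y) -> adapted_null_frame G vol y m p n k ->
  weyl_at G y m k m k = 0 -> weyl_at G y m k n k = 0 -> weyl_at G y m k p n = 0 ->
  weyl_at G y p n m p = 0 -> type_N G vol y \/ type_0 G vol y.
Proof.
move=> asym af P0 P1 P2 P3; have [nf sd] := af.
have QE : weyl_quartic G y m p n k = weyl_at G y p n p n *: 'X^4.
  rewrite /weyl_quartic /Psi0 /Psi1 /Psi2 /Psi3 /Psi4 P0 P1 P2 P3.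
  by rewrite !mulr0 !scale0r !addr0 subr0.
have [P4|P4] := eqVneq (weyl_at G y p n p n) 0; last first.
  (* The parameter 0 stands for the plane span(m, k) itself. *)
  left; exists m, p, n, k, (Some 0); split => //; rewrite QE.
    by rewrite scaler_eq0 negb_or P4 -size_poly_eq0 size_polyXn.
  by rewrite /quartic_root subr0 dvdpZr.
right=> a b c d; rewrite /weyl_selfdual.
have span v : exists a' b' c' d' : K, v = a' *: m + b' *: p + c' *: n + d' *: k.
  by rewrite [v](frame_span symG nf); do 4 eexists.
rewrite (hodge_form_antiselfdual symG unitG nf sd).
- by rewrite !mxE subrr mulr0.
- by apply/matrixP=> e f; rewrite !mxE asym.
- rewrite -weyl_at_delta.
  by have [-> _ _] := form_selfdual_part0 hC (tr nf) span (delta_mx 0 c) (delta_mx 0 d) P0 P1 P2 P3 P4.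
- rewrite -weyl_at_delta.
  by have [_ -> _] := form_selfdual_part0 hC (tr nf) span (delta_mx 0 c) (delta_mx 0 d) P0 P1 P2 P3 P4.
- rewrite -!weyl_at_delta.
  by have [_ _ ->] := form_selfdual_part0 hC (tr nf) span (delta_mx 0 c) (delta_mx 0 d) P0 P1 P2 P3 P4.
Qed.

End PrincipalPlane.

Section Restriction.
Context {R : realType}.
Implicit Types (U V : set 'rV[R]_4).

Lemma csmooth_on_sub U V (f : 'rV[R]_4 -> R[i]) : U `<=` V -> csmooth_on V f -> csmooth_on U f.
Proof. by move=> UV [fr fi]; split => s y Uy; [exact: fr (UV _ Uy) | exact: fi (UV _ Uy)]. Qed.

Lemma cmxsmooth_on_sub U V m n (X : 'rV[R]_4 -> 'M[R[i]]_(m, n)) :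
  U `<=` V -> cmxsmooth_on V X -> cmxsmooth_on U X.
Proof. by move=> UV sX a b; exact: csmooth_on_sub (sX a b). Qed.

(** Genericity speaks of points of the manifold, while the argument runs in a chart; continuity of
    the chart map transports neighbourhoods. *)
Lemma chart_near (M : topologicalType) (c : chart R M) y (S : set 'rV[R]_4) :
  cod c y -> nbhs y S ->
  \forall x \near chart_inv c y, dom c x /\ S (chart_map c x).
Proof.
move=> cy Sy; have dx := chart_inv_dom cy.
have nd : nbhs (chart_inv c y) (dom c).
  exact: open_nbhs_nbhs (conj (@dom_open _ _ c) dx).
have := @chart_map_continuous _ _ c.
rewrite continuous_open_subspace; last exact: dom_open.
move=> /(_ (chart_inv c y)); rewrite inE => /(_ dx) cont.
have Sx : nbhs (chart_map c (chart_inv c y)) S by rewrite chart_invK.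
by apply: filterS2 nd (cont _ Sx) => x.
Qed.

End Restriction.

Theorem theorem5p31 (R : realType) (M : manifold4 R) (g : cmetric M)
    (o : orientation g) (N : null_plane_field g)
    (generic : III_generic o)
    (special : algebraically_special_everywhere o)
    (selfdual : selfdual_field o N)
    (principal : multiple_principal_field o N)
    (cotton0 : cotton_vanishes_on N) :
  integrable_field N.
Proof.
move=> i W X Y openW WU sX sY inX inY y Wy; apply: contrapT => notin.
have [W' [X1 [X2 [oW' W'y s1' s2' PE]]]] := plane_smooth N (WU y Wy).
pose V : {V : set 'rV[R]_4 | open V} := exist _ (W `&` W') (openI openW oW').
have Vy : sval V y by [].
have Vc z : sval V z -> cod (atlas i) z by move=> [/WU].
have smoothG : cmxsmooth_on (sval V) (metric g i).
  exact: cmxsmooth_on_sub (metric_smooth g i).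
have symG z (Vz : sval V z) := metric_sym g (Vc z Vz).
have unitG z (Vz : sval V z) := metric_nondegenerate g (Vc z Vz).
have s1 : cmxsmooth_on (sval V) X1 by apply: cmxsmooth_on_sub s1' => z [].
have s2 : cmxsmooth_on (sval V) X2 by apply: cmxsmooth_on_sub s2' => z [].
have sX' : cmxsmooth_on (sval V) X by apply: cmxsmooth_on_sub sX => z [].
have sY' : cmxsmooth_on (sval V) Y by apply: cmxsmooth_on_sub sY => z [].
have PV z : sval V z -> plane N i z = <<[:: X1 z; X2 z]>>%VS.
  by move=> Vz; apply: PE (Vc _ Vz); case: Vz.
have in1 z : sval V z -> X1 z \in plane N i z.
  by move=> Vz; rewrite PV// memv_span// !inE eqxx.
have in2 z : sval V z -> X2 z \in plane N i z.
  by move=> Vz; rewrite PV// memv_span// !inE eqxx orbT.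
have null11 z (Vz : sval V z) := plane_null (Vc z Vz) (in1 z Vz) (in1 z Vz).
have null12 z (Vz : sval V z) := plane_null (Vc z Vz) (in1 z Vz) (in2 z Vz).
have null22 z (Vz : sval V z) := plane_null (Vc z Vz) (in2 z Vz) (in2 z Vz).
have hC z (Vz : sval V z) := weyl_curvature_form smoothG symG unitG Vz.
have tr z (Vz : sval V z) m p n k (nf : null_frame (metric g i) z m p n k) :=
  weyl_trace_free smoothG symG unitG Vz nf.
have frame z : sval V z -> exists p n, null_frame (metric g i) z (X1 z) p n (X2 z) /\
    forall v, weyl_at (metric g i) z (X1 z) (X2 z) (X1 z) v = 0 /\
      weyl_at (metric g i) z (X1 z) (X2 z) (X2 z) v = 0.
  move=> Vz; have := principal i z (Vc z Vz); have := plane_dim N (Vc z Vz).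
  rewrite PV// => dim2 princ.
  exact: (principal_frame (symG z Vz) (hC z Vz) (tr z Vz) princ dim2).
have aligned1 z v : sval V z -> weyl_at (metric g i) z (X1 z) (X2 z) (X1 z) v = 0.
  by move=> Vz; have [p [n [_ /(_ v)[]]]] := frame z Vz.
have aligned2 z v : sval V z -> weyl_at (metric g i) z (X1 z) (X2 z) (X2 z) v = 0.
  by move=> Vz; have [p [n [_ /(_ v)[]]]] := frame z Vz.
have cotton12 z (Vz : sval V z) u := cotton0 i z (Vc z Vz) u _ _ (in1 z Vz) (in2 z Vz).
have cotton21 z (Vz : sval V z) u := cotton0 i z (Vc z Vz) u _ _ (in2 z Vz) (in1 z Vz).
pose rot z := rotation smoothG unitG X2 s1 z.
have nearV : \forall z \near y, sval V z.
  exact: open_nbhs_nbhs (conj (svalP V) Vy).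
(* If sigma vanished on both sections at [y], the bracket would lie in the plane there; otherwise a
   nonzero value persists nearby, by continuity of [rotation_fun]. *)
have rotP : \forall z \near y, rot z (X1 z) != 0 \/ rot z (X2 z) != 0.
  have near_rot Z (sZ : cmxsmooth_on (sval V) Z) : rot y (Z y) != 0 ->
      \forall z \near y, rot z (Z z) != 0.
    move=> r0; have := csmooth_neq0_near
      (csmooth_funP (rotation_fun smoothG unitG s1 s2 sZ)) Vy.
    rewrite rotation_funE// => /(_ r0); apply: filterS2 nearV => z Vz.
    by rewrite rotation_funE.
  have [r1|r1] := eqVneq (rot y (X1 y)) 0; last first.
    by apply: filterS (near_rot _ s1 r1) => z; left.
  have [r2|r2] := eqVneq (rot y (X2 y)) 0; last first.
    by apply: filterS (near_rot _ s2 r2) => z; right.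
  case: notin; rewrite PV//; have [p [n [nf _]]] := frame y Vy.
  apply: (lie_bracket_in_plane symG s2 null11 null12 null22 Vy nf sX' sY' _ _ r1 r2).
    by move=> z Vz; rewrite -PV//; apply: inX; case: Vz.
  by move=> z Vz; rewrite -PV//; apply: inY; case: Vz.
have Psi2 : \forall z \near y, forall u v, weyl_at (metric g i) z u v (X1 z) (X2 z) = 0.
  apply: filterS2 rotP nearV => z rz Vz u v.
  have [p [n [nf _]]] := frame z Vz.
  have [r1 r2] := rotation_Psi2 smoothG symG unitG s1 s2 null11 null12 null22 Vz nf (cotton12 z Vz)
    (cotton21 z Vz) aligned1 aligned2.
  have P2 : weyl_at (metric g i) z (X1 z) (X2 z) p n = 0.
    case: rz => /negPf r0; apply/eqP; [move/eqP: r1|move/eqP: r2];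
      by rewrite mulf_eq0 r0.
  have span w : exists a b c d, w = a *: X1 z + b *: p + c *: n + d *: X2 z.
    by rewrite [w](frame_span (symG z Vz) nf); do 4 eexists.
  apply: (form_aligned_Psi2 (hC z Vz) (tr z Vz _ _ _ _ nf) span _ _ _ _ P2).
  - exact: aligned1.
  - by rewrite (form_asym34 (hC z Vz)) aligned2 ?oppr0.
have special_near : \forall z \near y,
    type_N (metric g i) (vol o i) z \/ type_0 (metric g i) (vol o i) z.
  (* The vanishing of C(., ., X1, X2) is to be differentiated at each nearby point, so it is needed
     on a neighbourhood of each of these points. *)
  have near3 := nbhs_interior Psi2.
  near=> z.
  have rz : rot z (X1 z) != 0 \/ rot z (X2 z) != 0 by near: z.
  have Vz : sval V z by near: z.
  have Cz : \forall w \near z, forall u v,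
      weyl_at (metric g i) w u v (X1 w) (X2 w) = 0 by near: z.
  have [p [n [nf _]]] := frame z Vz.
  have [r1 r2] := rotation_Psi3 smoothG symG unitG s1 s2 null11 null12 null22 Vz nf (cotton12 z Vz)
    (cotton21 z Vz) aligned1 aligned2 Cz.
  have P3 : weyl_at (metric g i) z p n (X1 z) p = 0.
    case: rz => /negPf r0; apply/eqP; [move/eqP: r1|move/eqP: r2];
      by rewrite mulf_eq0 r0.
  apply: (type_N_or_0 (symG z Vz) (unitG z Vz) (hC z Vz) (tr z Vz) (m := X1 z) (p := p)
    (n := n) (k := X2 z)) => //.
  - by move=> a b c d; have [] := weyl_symmetries smoothG symG unitG a b c d Vz.
  - by split => //; rewrite -PV//; apply: selfdual; exact: Vc.
  - exact: aligned1.
  - by rewrite (form_asym34 (hC z Vz)) aligned2 ?oppr0.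
  - by rewrite (form_pair (hC z Vz) p n) (nbhs_singleton Cz).
(* The points of type N or 0 now fill a neighbourhood in the manifold, which makes the base point
   interior to [F]. *)
have [F [_ F0 FP]] := generic.
have : interior F (chart_inv (atlas i) y).
  apply: filterS (chart_near (Vc y Vy) special_near) => x [dx Nx].
  exact: FP dx Nx.
by rewrite F0.
Unshelve. all: by end_near. Qed.
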